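(* Let $d,s\ge2$, $\rho\in(0,1)$, and let $\mu_X$ be a Borel probability measure on $\mathbb{R}^d$ with a $C^1$ density and compact support. Let $X_1,X_2,\dots$ be i.i.d. with law $\mu_X$, and let $\mu^*$ be a probability measure on $\mathbb{R}^d\times\mathbb{R}^s$ such that for some subsequence $n_k$, $\mu_{n_k}$ converges weakly to $\mu^*$ and $I_\rho(\mu^* )=\inf_{\mu\in\widetilde{\mathcal P}_X}I_\rho(\mu)$. Then $\mu^*$ has compact support.
   Context: t-SNE: For $n\ge2$ and $X_1,\dots,X_n\in\mathbb{R}^d$, choose $\sigma_i>0$ with $-\sum_{j\neq i}p_{j|i}\log p_{j|i}=\log(n\rho)$, where $p_{j|i}=\exp(-\|X_i-X_j\|^2/2\sigma_i^2)/\sum_{k\neq i}\exp(-\|X_i-X_k\|^2/2\sigma_i^2)$. Set $p_{ij}=(p_{i|j}+p_{j|i})/(2n)$ ($i\ne j$), $p_{ii}=0$; for $Y\in(\mathbb{R}^s)^n$, $q_{ij}=(1+\|Y_i-Y_j\|^2)^{-1}/\sum_{k\neq\ell}(1+\|Y_k-Y_\ell\|^2)^{-1}$ ($i\ne j$), $q_{ii}=0$, $L_{n,\rho}(X,Y)=\sum_{i\neq j}p_{ij}\log(p_{ij}/q_{ij})$. $Y^*$ is a minimizer of $L_{n,\rho}(X,\cdot)$ and $\mu_n=\frac1n\sum_i\delta_{(X_i,Y_i^* )}$. Limit objects: For a probability measure $\mu$ on $\mathbb{R}^d\times\mathbb{R}^s$, $w_{x,\sigma}(x')=\exp(-\|x-x'\|^2/2\sigma^2)/\int\exp(-\|x-z\|^2/2\sigma^2)d\mu(z)$,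 $F_{\rho,\mu}(x,\sigma)=\int w_{x,\sigma}\log w_{x,\sigma}\,d\mu(x')+\log\rho$, $\sigma^*_{\rho,\mu}(x)$ the unique $\sigma>0$ with $F_{\rho,\mu}(x,\sigma)=0$; $p_\psi(x,x')=\frac12\Big(\frac{e^{-\|x-x'\|^2/2\psi(x)^2}}{\int e^{-\|x-z\|^2/2\psi(x)^2}d\mu(z)}+\frac{e^{-\|x-x'\|^2/2\psi(x')^2}}{\int e^{-\|z-x'\|^2/2\psi(x')^2}d\mu(z)}\Big)$; $q(y,y')=(1+\|y-y'\|^2)^{-1}/\iint(1+\|u-u'\|^2)^{-1}d\mu d\mu$; $I_\rho(\mu)=\iint p_{\sigma^*_{\rho,\mu}}\log(p_{\sigma^*_{\rho,\mu}}/q)\,d\mu\,d\mu$. $\mathcal P_X$ = probability measures on $\mathbb{R}^d\times\mathbb{R}^s$ with $\mathbb{R}^d$-marginal $\mu_X$; $\widetilde{\mathcal P}_X$ = those $\mu\in\mathcal P_X$ with $\int(p(x,x')-q(y,y'))\frac{y-y'}{1+\|y-y'\|^2}d\mu(x',y')=0$ for $\mu$-a.e. $(x,y)$, with $p=p_{\sigma^*_{\rho,\mu}}$, $q$ computed from $\mu$. *)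

(* Defs.v *)
From HB Require Import structures.
From mathcomp Require Import all_boot all_order all_algebra.
From mathcomp Require Import all_classical all_reals all_analysis.
Set Implicit Arguments. Unset Strict Implicit. Unset Printing Implicit Defensive.
Import Order.TTheory GRing.Theory Num.Theory.
Import numFieldNormedType.Exports.
Local Open Scope classical_set_scope.
Local Open Scope ring_scope.

HB.instance Definition _ (T U : ptopologicalType) := Pointed.on (T * U)%type.

Definition borel_type (T : ptopologicalType) := g_sigma_algebraType (@open T).

Definition sqn (R : realType) (k : nat) (x y : 'rV[R]_k) : R :=
  \sum_(i < k) (x 0 i - y 0 i) ^+ 2.

Definition gk (R : realType) (d : nat) (sig : R) (x x' : 'rV[R]_d) : R :=
  expR (- sqn x x' / (2 * sig ^+ 2)).

Definition pcond (R : realType) (d n : nat) (X : 'I_n -> 'rV[R]_d)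
    (sig : 'I_n -> R) (i j : 'I_n) : R :=
  if i == j then 0
  else gk (sig i) (X i) (X j) / \sum_(k < n | k != i) gk (sig i) (X i) (X k).

Definition calibrated (R : realType) (d n : nat) (rho : R)
    (X : 'I_n -> 'rV[R]_d) (sig : 'I_n -> R) : Prop :=
  forall i : 'I_n, 0 < sig i /\
    - (\sum_(j < n | j != i) pcond X sig i j * ln (pcond X sig i j))
    = ln (n%:R * rho).

Definition pjoint (R : realType) (d n : nat) (X : 'I_n -> 'rV[R]_d)
    (sig : 'I_n -> R) (i j : 'I_n) : R :=
  if i == j then 0 else (pcond X sig j i + pcond X sig i j) / (2 * n%:R).

Definition qjoint (R : realType) (s n : nat) (Y : 'I_n -> 'rV[R]_s)
    (i j : 'I_n) : R :=
  if i == j then 0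
  else (1 + sqn (Y i) (Y j))^-1 /
       \sum_(k < n) \sum_(l < n | l != k) (1 + sqn (Y k) (Y l))^-1.

Definition tsne_loss (R : realType) (d s n : nat) (X : 'I_n -> 'rV[R]_d)
    (sig : 'I_n -> R) (Y : 'I_n -> 'rV[R]_s) : R :=
  \sum_(i < n) \sum_(j < n | j != i)
     pjoint X sig i j * ln (pjoint X sig i j / qjoint Y i j).

Definition is_tsne_minimizer (R : realType) (d s n : nat)
    (X : 'I_n -> 'rV[R]_d) (sig : 'I_n -> R) (Y : 'I_n -> 'rV[R]_s) : Prop :=
  forall Y' : 'I_n -> 'rV[R]_s, tsne_loss X sig Y <= tsne_loss X sig Y'.

Definition empirical (R : realType) (T : ptopologicalType) (n : nat)
    (Z : nat -> borel_type T) : {measure set (borel_type T) -> \bar R} :=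
  mscale ((n%:R)^-1)%:nng (msum (fun i => @dirac _ (borel_type T) (Z i) R) n).

Definition weak_cvg (R : realType) (T : ptopologicalType)
    (mus : nat -> {measure set (borel_type T) -> \bar R})
    (mu : {measure set (borel_type T) -> \bar R}) : Prop :=
  forall f : T -> R, continuous f -> (exists M : R, forall z, `|f z| <= M) ->
    (fun k => (\int[mus k]_z (f z)%:E)%E) @ \oo
      --> (\int[mu]_z (f z)%:E)%E.

Definition msupport (R : realType) (T : ptopologicalType)
    (mu : set (borel_type T) -> \bar R) : set T :=
  [set z | forall U : set T, open U -> U z -> (0 < mu U)%E].

Definition mutually_independent d (Omega : measurableType d) (R : realType)
    (P : probability Omega R) (T : ptopologicalType)
    (X : nat -> Omega -> borel_type T) : Prop :=
  forall (I : seq nat) (A : nat -> set (borel_type T)), uniq I ->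
    (forall i, i \in I -> measurable (A i)) ->
    P (\big[setI/setT]_(i <- I) (X i @^-1` A i)) =
    (\prod_(i <- I) P (X i @^-1` A i))%E.

Fixpoint lebint (R : realType) (d : nat) : ('rV[R]_d -> \bar R) -> \bar R :=
  match d return ('rV[R]_d -> \bar R) -> \bar R with
  | 0 => fun f => f 0
  | d'.+1 => fun f =>
      (\int[@lebesgue_measure R]_t
         lebint (fun v : 'rV[R]_d' => f (row_mx (const_mx t : 'rV[R]_1) v)))%E
  end.

Definition has_density (R : realType) (d : nat)
    (mu : set (borel_type 'rV[R]_d) -> \bar R) (f : 'rV[R]_d -> R) : Prop :=
  (forall x, 0 <= f x) /\
  forall A : set (borel_type 'rV[R]_d), measurable A ->
    mu A = lebint (fun x => (\1_A x * f x)%:E).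

Definition C1 (R : realType) (d : nat) (f : 'rV[R]_d -> R) : Prop :=
  forall i : 'I_d,
    (forall x, derivable f x (delta_mx 0 i)) /\
    continuous (fun x => 'D_(delta_mx 0 i) f x).

Definition BT (R : realType) (d s : nat) := borel_type ('rV[R]_d * 'rV[R]_s)%type.

Definition wfun (R : realType) (d s : nat) (mu : probability (BT R d s) R)
    (sig : R) (x x' : 'rV[R]_d) : R :=
  gk sig x x' / Rintegral mu setT (fun z : BT R d s => gk sig x z.1).

Definition Ffun (R : realType) (d s : nat) (rho : R)
    (mu : probability (BT R d s) R) (x : 'rV[R]_d) (sig : R) : R :=
  Rintegral mu setT (fun z : BT R d s => wfun mu sig x z.1 * ln (wfun mu sig x z.1))
  + ln rho.

Definition sigstar (R : realType) (d s : nat) (rho : R)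
    (mu : probability (BT R d s) R) (x : 'rV[R]_d) : R :=
  xget 1 [set sig : R | 0 < sig /\ Ffun rho mu x sig = 0].

Definition pfun (R : realType) (d s : nat) (rho : R)
    (mu : probability (BT R d s) R) (x x' : 'rV[R]_d) : R :=
  (wfun mu (sigstar rho mu x) x x' + wfun mu (sigstar rho mu x') x' x) / 2.

Definition Zq (R : realType) (d s : nat) (mu : probability (BT R d s) R) : R :=
  Rintegral mu setT (fun u : BT R d s =>
    Rintegral mu setT (fun u' : BT R d s => (1 + sqn u.2 u'.2)^-1)).

Definition qfun (R : realType) (d s : nat) (mu : probability (BT R d s) R)
    (y y' : 'rV[R]_s) : R :=
  (1 + sqn y y')^-1 / Zq mu.

Definition Irho (R : realType) (d s : nat) (rho : R)
    (mu : probability (BT R d s) R) : \bar R :=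
  (\int[mu]_z \int[mu]_z'
     (pfun rho mu z.1 z'.1 * ln (pfun rho mu z.1 z'.1 / qfun mu z.2 z'.2))%:E)%E.

Definition in_PX (R : realType) (d s : nat)
    (muX : probability (borel_type 'rV[R]_d) R)
    (mu : probability (BT R d s) R) : Prop :=
  forall A : set (borel_type 'rV[R]_d), measurable A ->
    mu (A `*` setT) = muX A.

(** tilde P_X : stationarity condition holds mu-a.e. (componentwise). *)
Definition in_PtX (R : realType) (d s : nat) (rho : R)
    (muX : probability (borel_type 'rV[R]_d) R)
    (mu : probability (BT R d s) R) : Prop :=
  in_PX muX mu /\
  {ae mu, forall z : BT R d s, forall j : 'I_s,
     (\int[mu]_z'
       ((pfun rho mu z.1 z'.1 - qfun mu z.2 z'.2) * (z.2 0 j - z'.2 0 j)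
          / (1 + sqn z.2 z'.2))%:E = 0)%E}.

(* Main.v *)
Require Import Defs.
From HB Require Import structures.
From mathcomp Require Import all_boot all_order all_algebra.
From mathcomp Require Import all_classical all_reals all_analysis.
From mathcomp Require Import measurable_realfun ring lra.
Import Order.TTheory GRing.Theory Num.Theory.
Import numFieldNormedType.Exports.
Local Open Scope classical_set_scope.
Local Open Scope ring_scope.

(** Minimality of the finite embeddings alone forces the points [Y_i] to stay in
    a ball that does not depend on [n].  Write [N_i = |Y_i|^2],
    [D_ij = |Y_i - Y_j|^2], and let [t_n(T)] be the fraction of points with
    [N_i >= T].  Pushing [Y] along [-h] cannot decrease the loss, so the
    attraction [sum p_ij E_ij / (1 + D_ij)] is at most twice the repulsion
    [sum q_ij E_ij / (1 + D_ij)], where [E_ij = <Y_i - Y_j, h_i - h_j> >= 0].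

    Near a point of the support of the limit there is a positive fraction of
    bounded [Y_j] whose bandwidths are bounded below (the law of the data has no
    atoms, so the entropy calibration prevents the kernels from concentrating);
    these points attract every other one, [p_ij >= c / n^2].  With
    [h_i = (1 - T / N_i)^+ Y_i] this gives
    [t_n(4T) <= K t_n(T) (t_n(T/4) + 4/T)], and tightness of the weakly
    convergent sequence starts the recursion: [t_n(T) = O(T^-2)] uniformly in
    [n].  Moving only an outermost point, with [N = max_i N_i], gives
    [1 <= K ((N + 1) t_n(N/4) + 20/N)], hence a bound on [N]. *)

(** * Squared Euclidean distance and radial fields *)

Section SquaredDistance.
Context {R : realType} {k : nat}.
Implicit Types x y z : 'rV[R]_k.

Lemma sqn_ge0 x y : 0 <= sqn x y.
Proof. by apply: sumr_ge0 => i _; exact: sqr_ge0. Qed.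

Lemma sqnC x y : sqn x y = sqn y x.
Proof. by apply: eq_bigr => i _; rewrite -sqrrN opprB. Qed.

Lemma sqnn x : sqn x x = 0.
Proof. by apply: big1 => i _; rewrite subrr expr0n. Qed.

(** The parallelogram identity in each coordinate. It serves throughout as the triangle inequality,
    so that no square root is ever taken. *)
Lemma sqn_le2 x y z : sqn x z <= 2 * sqn x y + 2 * sqn y z.
Proof.
rewrite /sqn !mulr_sumr -big_split /=; apply: ler_sum => i _.
set a := x 0 i; set b := y 0 i; set c := z 0 i.
have := sqr_ge0 (a - b - (b - c)); nra.
Qed.

Definition dotp x y : R := \sum_(i < k) x 0 i * y 0 i.

(** Polarization. For nonnegative factors that grow with the norm both products on the right are
    nonnegative, which makes radial fields admissible in the variation. *)
Lemma dotp_scale_diff (l m : R) x y :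
  dotp (x - y) (l *: x - m *: y) =
  ((l - m) * (sqn x 0 - sqn y 0) + (l + m) * sqn x y) / 2.
Proof.
rewrite /dotp /sqn -sumrB !mulr_sumr -big_split /= mulr_suml.
by apply: eq_bigr => i _; rewrite !mxE; field.
Qed.

Lemma sqn_perturb (t : R) x y u v :
  sqn (x - t *: u) (y - t *: v) =
  sqn x y - 2 * t * dotp (x - y) (u - v) + t ^+ 2 * sqn u v.
Proof.
rewrite /dotp /sqn !mulr_sumr -sumrN -!big_split /=.
by apply: eq_bigr => i _; rewrite !mxE; ring.
Qed.

(* AM-GM: [t (|x|^2 - |y|^2) <= 2 |x - y|^2 + t^2 |x + y|^2 / 8], used with
   [t = (|x|^2 - |y|^2) / |x|^2]. *)
Lemma sqn_diff_le x y : sqn y 0 <= sqn x 0 ->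
  (sqn x 0 - sqn y 0) ^+ 2 / sqn x 0 <= 4 * sqn x y.
Proof.
move=> le_yx; have [x0|x_neq0] := eqVneq (sqn x 0) 0.
  by rewrite x0 invr0 mulr0 mulr_ge0 ?sqn_ge0.
have x_gt0 : 0 < sqn x 0 by rewrite lt_def x_neq0 sqn_ge0.
set t := (sqn x 0 - sqn y 0) / sqn x 0.
have tE : t * sqn x 0 = sqn x 0 - sqn y 0 by rewrite /t divfK.
have amgm : t * (sqn x 0 - sqn y 0) <=
    2 * sqn x y + t ^+ 2 / 8 * (2 * sqn x 0 + 2 * sqn y 0).
  rewrite /sqn -sumrB !mulr_sumr -big_split /= mulr_sumr -big_split /=.
  apply: ler_sum => i _; rewrite !mxE !subr0.
  set a := x 0 i; set b := y 0 i.
  have := sqr_ge0 (2 * (a - b) - t * (a + b) / 2).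
  have := mulr_ge0 (sqr_ge0 t) (sqr_ge0 (a - b)).
  nra.
have -> : (sqn x 0 - sqn y 0) ^+ 2 / sqn x 0 = t ^+ 2 * sqn x 0.
  by rewrite /t; field.
have := mulr_ge0 (sqr_ge0 t) (_ : 0 <= sqn x 0 - sqn y 0).
rewrite subr_ge0 => /(_ le_yx); rewrite -tE in amgm *.
have := sqn_ge0 y 0; nra.
Qed.

End SquaredDistance.

(** * Varying the embedding in the finite loss *)

Section Variation.
Context {R : realType} {d s n : nat}.
Variables (X : 'I_n -> 'rV[R]_d) (sig : 'I_n -> R).
Hypothesis n_ge2 : (2 <= n)%N.

Let n_gt0 : 0 < n%:R :> R.
Proof. by rewrite ltr0n; exact: leq_trans n_ge2. Qed.

Lemma exists_neq (i : 'I_n) : exists j : 'I_n, j != i.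
Proof.
have h0 : (0 < n)%N by exact: leq_trans n_ge2.
have [i0|i0] := eqVneq i (Ordinal h0).
  by exists (Ordinal n_ge2); rewrite i0.
by exists (Ordinal h0); rewrite eq_sym.
Qed.

Lemma sumr_neq_gt0 (F : 'I_n -> R) (i : 'I_n) :
  (forall j, 0 < F j) -> 0 < \sum_(j < n | j != i) F j.
Proof.
move=> F0; have [j ji] := exists_neq i.
rewrite (bigD1 j) //= ltr_wpDr ?F0 // sumr_ge0 // => l _; exact: ltW.
Qed.

Lemma gk_gt0 (sg : R) (x y : 'rV[R]_d) : 0 < gk sg x y.
Proof. exact: expR_gt0. Qed.

Lemma pcond_gt0 i j : i != j -> 0 < pcond X sig i j.
Proof.
move=> ij; rewrite /pcond (negbTE ij) divr_gt0 ?gk_gt0//.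
by apply: sumr_neq_gt0 => l; exact: gk_gt0.
Qed.

Lemma pcond_ge0 i j : 0 <= pcond X sig i j.
Proof.
by have [->|/pcond_gt0/ltW//] := eqVneq i j; rewrite /pcond eqxx.
Qed.

Lemma sum_pcond i : \sum_(j < n | j != i) pcond X sig i j = 1.
Proof.
have S0 : 0 < \sum_(l < n | l != i) gk (sig i) (X i) (X l).
  by apply: sumr_neq_gt0 => l; exact: gk_gt0.
rewrite -(divff (lt0r_neq0 S0)) mulr_suml; apply: eq_bigr => j ji.
by rewrite /pcond eq_sym (negbTE ji).
Qed.

Lemma pjoint_ge0 i j : 0 <= pjoint X sig i j.
Proof.
rewrite /pjoint; case: eqP => // _.
by rewrite divr_ge0 ?addr_ge0 ?pcond_ge0// mulr_ge0.
Qed.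

Lemma pjoint_gt0 i j : j != i -> 0 < pjoint X sig i j.
Proof.
move=> ji; rewrite /pjoint eq_sym (negbTE ji).
by rewrite divr_gt0 ?addr_gt0 ?pcond_gt0// 1?eq_sym// mulr_gt0.
Qed.

Lemma sum_pjoint : \sum_(i < n) \sum_(j < n | j != i) pjoint X sig i j = 1.
Proof.
have sw : \sum_(i < n) \sum_(j < n | j != i) pcond X sig j i = n%:R.
  rewrite (exchange_big_dep xpredT) //= (eq_bigr (fun _ => 1)).
    by rewrite sumr_const card_ord.
  move=> j _; rewrite -[RHS](sum_pcond j); apply: eq_bigl => i.
  by rewrite eq_sym.
transitivity (\sum_(i < n) \sum_(j < n | j != i)
    (pcond X sig j i + pcond X sig i j) / (2 * n%:R)).
  apply: eq_bigr => i _; apply: eq_bigr => j ji.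
  by rewrite /pjoint eq_sym (negbTE ji).
under eq_bigr do rewrite -mulr_suml big_split /=.
rewrite -mulr_suml big_split /= sw.
under eq_bigr do rewrite sum_pcond.
rewrite sumr_const card_ord; field; exact: lt0r_neq0.
Qed.

Definition Znorm (Y : 'I_n -> 'rV[R]_s) : R :=
  \sum_(k < n) \sum_(l < n | l != k) (1 + sqn (Y k) (Y l))^-1.

Lemma one_sqn_gt0 (x y : 'rV[R]_s) : 0 < 1 + sqn x y.
Proof. by rewrite ltr_wpDr ?sqn_ge0. Qed.

Lemma Znorm_gt0 Y : 0 < Znorm Y.
Proof.
have i0 : 'I_n by exact: (Ordinal n_ge2).
rewrite /Znorm (bigD1 i0) //= ltr_wpDr //.
  by apply: sumr_ge0 => i _; apply: sumr_ge0 => j _; rewrite invr_ge0 ltW// one_sqn_gt0.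
by apply: sumr_neq_gt0 => j; rewrite invr_gt0 one_sqn_gt0.
Qed.

Lemma qjointE Y i j : j != i -> qjoint Y i j = (1 + sqn (Y i) (Y j))^-1 / Znorm Y.
Proof. by move=> ji; rewrite /qjoint eq_sym (negbTE ji). Qed.

(** The weights [pjoint] have total mass one, so the logarithm of the normalizer comes out of the
    sum. The first term does not involve [Y] and cancels when two embeddings are compared. *)
Lemma tsne_loss_split Y : tsne_loss X sig Y =
  \sum_(i < n) \sum_(j < n | j != i) pjoint X sig i j * ln (pjoint X sig i j)
  + \sum_(i < n) \sum_(j < n | j != i)
      pjoint X sig i j * ln (1 + sqn (Y i) (Y j))
  + ln (Znorm Y).
Proof.
have -> : ln (Znorm Y) =
    (\sum_(i < n) \sum_(j < n | j != i) pjoint X sig i j) * ln (Znorm Y).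
  by rewrite sum_pjoint mul1r.
rewrite mulr_suml -!big_split /=.
apply: eq_bigr => i _; rewrite mulr_suml -!big_split /=.
apply: eq_bigr => j ji; rewrite qjointE//.
have D0 := one_sqn_gt0 (Y i) (Y j); have Z0 := Znorm_gt0 Y; have p0 := @pjoint_gt0 i j ji.
rewrite ln_div ?posrE ?divr_gt0 ?invr_gt0//.
by rewrite ln_div ?posrE ?invr_gt0// lnV ?posrE//; ring.
Qed.

Lemma ln_sub_le (a b : R) : 0 < a -> 0 < b -> ln a - ln b <= (a - b) / b.
Proof.
move=> a0 b0; rewrite -ln_div ?posrE//.
have -> : a / b = 1 + (a - b) / b by field; exact: lt0r_neq0.
apply: le_ln1Dx; rewrite -subr_gt0.
have -> : (a - b) / b - -1 = a / b by field; exact: lt0r_neq0.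
exact: divr_gt0.
Qed.

Lemma le_of_le_add_small (a b A t0 : R) : 0 < t0 -> 0 <= A ->
  (forall t, 0 < t -> t <= t0 -> a <= b + t * A) -> a <= b.
Proof.
move=> t00 A0 H; apply/ler_addgt0Pr => e e0.
have t1 : 0 < Num.min t0 (e / (A + 1)).
  by rewrite lt_min t00 divr_gt0// ltr_wpDl.
have := H _ t1; rewrite ge_min lexx /= => /(_ isT) /le_trans; apply.
rewrite lerD2l; apply: (@le_trans _ _ (e / (A + 1) * A)).
  by rewrite ler_wpM2r// ge_min lexx orbT.
by rewrite -mulrA ger_pMr// ler_pdivrMl ?ltr_wpDl// mulr1 lerDl.
Qed.

(* Moving from [Y] to [Y - t h] cannot decrease the loss; since [ln x <= x - 1],
   no differentiation is needed, at the harmless price of a factor 2. *)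
Lemma minimizer_contraction (Y h : 'I_n -> 'rV[R]_s) :
  is_tsne_minimizer X sig Y ->
  (forall i j, 0 <= dotp (Y i - Y j) (h i - h j)) ->
  \sum_(i < n) \sum_(j < n | j != i)
    pjoint X sig i j * (dotp (Y i - Y j) (h i - h j) / (1 + sqn (Y i) (Y j)))
  <= 2 * \sum_(i < n) \sum_(j < n | j != i)
    dotp (Y i - Y j) (h i - h j) / (1 + sqn (Y i) (Y j)) ^+ 2 / Znorm Y.
Proof.
move=> minY; pose E i j := dotp (Y i - Y j) (h i - h j).
rewrite -/(E _ _) => E0.
pose D i j := sqn (Y i) (Y j); pose F i j := sqn (h i) (h j).
pose p i j := pjoint X sig i j.
have D0 i j : 0 < 1 + D i j by exact: one_sqn_gt0.
pose S := \sum_(i < n) \sum_(j < n) E i j.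
have ES i j : E i j <= S.
  rewrite /S (bigD1 i) //= (bigD1 j) //= -addrA lerDl.
  apply: addr_ge0; apply: sumr_ge0 => k _; first exact: E0.
  by apply: sumr_ge0 => l _; exact: E0.
have S0 : 0 <= S by apply: sumr_ge0 => i _; apply: sumr_ge0 => j _; exact: E0.
pose A := \sum_(i < n) \sum_(j < n | j != i) p i j * (F i j / (1 + D i j)).
have A0 : 0 <= A.
  apply: sumr_ge0 => i _; apply: sumr_ge0 => j _.
  by rewrite mulr_ge0 ?pjoint_ge0 ?divr_ge0 ?sqn_ge0// ltW.
(* [S] dominates every [E i j], so on this range [4 * t * E i j <= 1] and moving the points at most
   halves [1 + D i j]. The error [t * A] disappears as [t] tends to 0. *)
suff main t : 0 < t -> t <= (4 * (S + 1))^-1 ->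
    2 * (\sum_(i < n) \sum_(j < n | j != i) p i j * (E i j / (1 + D i j)))
    <= 4 * (\sum_(i < n) \sum_(j < n | j != i) E i j / (1 + D i j) ^+ 2 / Znorm Y)
       + t * A.
  have := @le_of_le_add_small _ _ A (4 * (S + 1))^-1 _ A0 main.
  rewrite invr_gt0 mulr_gt0 ?ltr_wpDl// => /(_ isT).
  by rewrite /p /E /D; lra.
move=> t0 tS.
have := minY (fun i => Y i - t *: h i).
rewrite !tsne_loss_split -!addrA lerD2l -subr_ge0.
set Y' := fun i => Y i - t *: h i.
have Z0 := Znorm_gt0 Y; have Z0' := Znorm_gt0 Y'.
have D'E i j : sqn (Y' i) (Y' j) = D i j - 2 * t * E i j + t ^+ 2 * F i j.
  exact: sqn_perturb.
have lnZ := ln_sub_le _ _ Z0' Z0.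
(* A difference of reciprocals: the numerator [D - D'] is at most [2 * t * E], and replacing
   [1 + D'] by [(1 + D) / 2] in the denominator doubles the bound. *)
have ZZ : Znorm Y' - Znorm Y <= \sum_(i < n) \sum_(j < n | j != i)
    4 * t * (E i j / (1 + D i j) ^+ 2).
  rewrite /Znorm -sumrB; apply: ler_sum => i _; rewrite -sumrB; apply: ler_sum => j _.
  rewrite -/(D i j).
  have tE : 4 * t * E i j <= 1.
    have : 4 * t * E i j <= 4 * t * (S + 1).
      by rewrite ler_pM2l ?mulr_gt0// (le_trans (ES i j))// lerDl.
    have S1 : 0 < 4 * (S + 1) by rewrite mulr_gt0 ?ltr_wpDl.
    have tS1 : t * (4 * (S + 1)) <= 1 by rewrite -ler_pdivlMr// mul1r.
    move=> /le_trans; apply; lra.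
  have D'2 : (1 + D i j) / 2 <= 1 + sqn (Y' i) (Y' j).
    rewrite D'E; have := D0 i j; have := sqn_ge0 (Y i) (Y j); rewrite -/(D i j).
    have := mulr_ge0 (sqr_ge0 t) (sqn_ge0 (h i) (h j)); rewrite -/(F i j); lra.
  have D'0 := one_sqn_gt0 (Y' i) (Y' j).
  have -> : (1 + sqn (Y' i) (Y' j))^-1 - (1 + D i j)^-1 =
     (D i j - sqn (Y' i) (Y' j)) / ((1 + D i j) * (1 + sqn (Y' i) (Y' j))).
    field; rewrite ?lt0r_neq0//.
  rewrite ler_pdivrMr ?mulr_gt0//.
  have -> : 4 * t * (E i j / (1 + D i j) ^+ 2) * ((1 + D i j) * (1 + sqn (Y' i) (Y' j)))
      = 4 * t * E i j / (1 + D i j) * (1 + sqn (Y' i) (Y' j)).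
    by field; rewrite lt0r_neq0.
  apply: (@le_trans _ _ (4 * t * E i j / (1 + D i j) * ((1 + D i j) / 2))).
    have -> : 4 * t * E i j / (1 + D i j) * ((1 + D i j) / 2) = 2 * t * E i j.
      by field; rewrite lt0r_neq0.
    rewrite D'E; have := mulr_ge0 (sqr_ge0 t) (sqn_ge0 (h i) (h j)); rewrite -/(F i j); lra.
  apply: ler_wpM2l => //; apply: divr_ge0; last exact: ltW.
  by apply: mulr_ge0; [rewrite mulr_ge0 // ltW | exact: E0].
have lnD : \sum_(i < n) \sum_(j < n | j != i) p i j * ln (1 + sqn (Y' i) (Y' j))
    - \sum_(i < n) \sum_(j < n | j != i) p i j * ln (1 + D i j)
    <= - (2 * t) * (\sum_(i < n) \sum_(j < n | j != i) p i j * (E i j / (1 + D i j)))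
       + t ^+ 2 * A.
  rewrite /A !mulr_sumr -sumrB -big_split /=; apply: ler_sum => i _.
  rewrite !mulr_sumr -sumrB -big_split /=; apply: ler_sum => j _.
  have -> : - (2 * t) * (p i j * (E i j / (1 + D i j))) + t ^+ 2 * (p i j * (F i j / (1 + D i j)))
     = p i j * ((1 + sqn (Y' i) (Y' j) - (1 + D i j)) / (1 + D i j)).
    by rewrite D'E; ring.
  rewrite -mulrBr ler_wpM2l ?pjoint_ge0//; apply: ln_sub_le => //; exact: one_sqn_gt0.
rewrite -/(p _ _) => loss.
set P := (\sum_(i < n) \sum_(j < n | j != i) p i j * (E i j / (1 + D i j))) in lnD *.
have lnZ' : ln (Znorm Y') - ln (Znorm Y) <=
  4 * t * (\sum_(i < n) \sum_(j < n | j != i) E i j / (1 + D i j) ^+ 2 / Znorm Y).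
  apply: (le_trans lnZ); rewrite ler_pdivrMr//; apply: (le_trans ZZ).
  rewrite le_eqVlt; apply/orP; left; apply/eqP.
  move: (Znorm Y) Z0 => Z Z0.
  rewrite mulr_sumr mulr_suml; apply: eq_bigr => i _.
  rewrite mulr_sumr mulr_suml; apply: eq_bigr => j _.
  by field; rewrite !lt0r_neq0.
set Q := (\sum_(i < n) \sum_(j < n | j != i) E i j / (1 + D i j) ^+ 2 / Znorm Y) in lnZ' *.
have : 0 <= t * (4 * Q + t * A - 2 * P) by move: loss lnZ' lnD; rewrite /p /D; lra.
by rewrite pmulr_rge0// subr_ge0.
Qed.

End Variation.

(** * Entropy calibration and lower bounds on the affinities *)

Section Bandwidth.
Context {R : realType} {d n : nat}.
Variables (X : 'I_n -> 'rV[R]_d) (sig : 'I_n -> R) (rho : R) (m : nat).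
Hypotheses (n_ge2 : (2 <= n)%N) (rho01 : 0 < rho < 1).
Hypothesis m_rho : 4 < m%:R * rho ^+ 2.
Hypothesis calX : calibrated rho X sig.

Let n_gt0 : 0 < n%:R :> R.
Proof. by rewrite ltr0n; exact: leq_trans n_ge2. Qed.

Let m_gt0 : 0 < m%:R :> R.
Proof.
rewrite ltr0n lt0n; apply/eqP => m0.
by move: m_rho; rewrite m0 mul0r ltNge ler0n.
Qed.

(* Gibbs' inequality against the weights m/(2n) on A and 1/(2n) off A. *)
Lemma calibrated_spread (A : {set 'I_n}) (j : 'I_n) : (m * #|A| <= n)%N ->
  2^-1 <= \sum_(k < n | (k != j) && (k \notin A)) pcond X sig j k.
Proof.
move=> mA; have [_ ent] := calX j.
pose p k := pcond X sig j k.
pose q (k : 'I_n) : R := (if k \in A then m%:R else 1) / (2 * n%:R).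
have q0 k : 0 < q k by rewrite /q; case: ifP => _; rewrite divr_gt0// mulr_gt0.
have p0 k : k != j -> 0 < p k by move=> kj; apply: pcond_gt0; rewrite // eq_sym.
have gibbs : \sum_(k < n | k != j) (p k * ln (q k) - p k * ln (p k)) <=
    \sum_(k < n | k != j) (q k - p k).
  apply: ler_sum => k kj; rewrite -mulrBr.
  have := ln_sub_le (q k) (p k) (q0 k) (p0 k kj).
  by rewrite ler_pdivlMr ?p0// mulrC.
have sq : \sum_(k < n | k != j) q k <= 1.
  apply: (@le_trans _ _ (\sum_(k < n) q k)).
    rewrite [leRHS](bigID (fun k => k != j)) /= lerDl sumr_ge0// => k _; exact: ltW.
  rewrite /q -mulr_suml ler_pdivrMr ?mulr_gt0// mul1r mulr_natl mulr2n.
  rewrite (bigID (fun k => k \in A)) /=; apply: lerD.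
    rewrite (eq_bigr (fun _ => m%:R)) => [|k ->//].
    by rewrite sumr_const -mulrnA ler_nat.
  rewrite (eq_bigr (fun _ => 1)) => [|k /negbTE ->//].
  by rewrite sumr_const ler_nat (leq_trans (max_card _))// card_ord.
have lnq k : ln (q k) = (if k \in A then ln m%:R else 0) - ln (2 * n%:R).
  by rewrite /q; case: ifP => _; rewrite ln_div ?posrE ?mulr_gt0// ln1.
have sp := sum_pcond X sig n_ge2 j.
move: gibbs; rewrite !sumrB sp -/(p _).
have -> : \sum_(k < n | k != j) p k * ln (p k) = - ln (n%:R * rho).
  by rewrite -ent opprK.
have -> : \sum_(k < n | k != j) p k * ln (q k) =
    (\sum_(k < n | (k != j) && (k \in A)) p k) * ln m%:R - ln (2 * n%:R).
  have -> : ln (2 * n%:R) = \sum_(k < n | k != j) p k * ln (2 * n%:R).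
    by rewrite -mulr_suml sp mul1r.
  rewrite big_mkcondr /= mulr_suml -sumrB; apply: eq_bigr => k kj.
  by rewrite lnq mulrBr; case: ifP; rewrite ?mul0r ?mulr0.
have spA : \sum_(k < n | (k != j) && (k \in A)) p k =
   1 - \sum_(k < n | (k != j) && (k \notin A)) p k.
  by apply/eqP; rewrite eq_sym subr_eq -sp (bigID (fun k => k \in A)).
case/andP: rho01 => rho0 rho1.
rewrite spA !lnM ?posrE// -/(p _).
(* This is [m_rho] in logarithms. Gibbs' inequality will give [(1 - S) * ln m <= ln 2 - ln rho],
   which is then incompatible with [S < 1/2]. *)
have lnm : 2 * (ln 2 - ln rho) < ln m%:R.
  have -> : 2 * (ln 2 - ln rho) = ln (4 / rho ^+ 2) :> R.
    rewrite ln_div ?posrE ?exprn_gt0// lnXn//.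
    have -> : 4 = 2 ^+ 2 :> R by ring.
    by rewrite lnXn// !mulr2n; ring.
  by rewrite ltr_ln ?posrE ?divr_gt0 ?exprn_gt0// ltr_pdivrMr ?exprn_gt0.
have l2 : 0 < ln 2 - ln rho :> R.
  have h2 : 0 < ln 2 :> R by rewrite ln_gt0// ltr1n.
  have : ln rho <= 0 by rewrite ln_le0// ltW.
  lra.
set S := \sum_(k < n | _) p k => H.
have {H} : (1 - S) * ln m%:R <= ln 2 - ln rho by move: H sq; lra.
have : 0 <= S by apply: sumr_ge0 => k _; exact: pcond_ge0.
clear -lnm l2; move=> S0 H; rewrite leNgt; apply/negP => S2.
have : (1 - S) * (2 * (ln 2 - ln rho)) <= (1 - S) * ln m%:R.
  by rewrite ler_wpM2l; lra.
have : 0 < (2^-1 - S) * (ln 2 - ln rho) by rewrite mulr_gt0; lra.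
lra.
Qed.

(** At least half of the conditional mass lies off [A], at squared distance at least [f], while the
    points of [C] alone keep the normalizer above [theta * n * exp (- g * b)], with [b] the inverse
    of [2 * sig j ^ 2]. Comparing the two gives [theta / 2 <= exp (- (f - g) * b)]. Since the
    normalizer omits [j], so must [C]. *)
Lemma calibrated_bandwidth (A C : {set 'I_n}) (j : 'I_n) (theta f g : R) :
  (m * #|A| <= n)%N -> 0 < theta -> theta * n%:R <= #|C|%:R -> j \notin C ->
  (forall k, k \notin A -> f <= sqn (X j) (X k)) ->
  (forall k, k \in C -> sqn (X j) (X k) <= g) ->
  g < f ->
  (2 * sig j ^+ 2)^-1 <= ln (2 / theta) / (f - g).
Proof.
move=> mA th0 thC jC farA nearC gf.
have [sj0 _] := calX j.
have := calibrated_spread A j mA.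
set S := \sum_(k < n | k != j) gk (sig j) (X j) (X k).
set b := (2 * sig j ^+ 2)^-1.
have b0 : 0 < b by rewrite invr_gt0 mulr_gt0 ?exprn_gt0.
have gkE k : gk (sig j) (X j) (X k) = expR (- sqn (X j) (X k) * b) by [].
have SC : theta * n%:R * expR (- g * b) <= S.
  apply: (@le_trans _ _ (#|C|%:R * expR (- g * b))).
    by rewrite ler_wpM2r// expR_ge0.
  rewrite mulr_natl -sumr_const.
  apply: (@le_trans _ _ (\sum_(k in C) gk (sig j) (X j) (X k))).
    apply: ler_sum => k kC; rewrite gkE ler_expR !mulNr lerN2 ler_wpM2r ?nearC//.
    exact: ltW.
  rewrite /S big_mkcond [leRHS]big_mkcond /=; apply: ler_sum => k _.
  case: ifP => [kC|_]; last by case: ifP => // _; exact/ltW/gk_gt0.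
  by case: eqP kC => [->|//]; rewrite (negbTE jC).
have S0 : 0 < S by apply: lt_le_trans SC; rewrite !mulr_gt0// expR_gt0.
have far : \sum_(k < n | (k != j) && (k \notin A)) pcond X sig j k
     <= n%:R * expR (- f * b) / S.
  rewrite (eq_bigr (fun k => gk (sig j) (X j) (X k) / S)); last first.
    by move=> k /andP[kj _]; rewrite /pcond eq_sym (negbTE kj).
  rewrite -mulr_suml ler_wpM2r ?invr_ge0 ?(ltW S0)//.
  apply: (@le_trans _ _ (\sum_(k < n | (k != j) && (k \notin A)) expR (- f * b))).
    apply: ler_sum => k /andP[_ kA].
    rewrite gkE ler_expR !mulNr lerN2 ler_wpM2r ?farA//; exact: ltW.
  rewrite sumr_const mulr_natl; apply: ler_wpMn2l; first exact: expR_ge0.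
  by rewrite (leq_trans (max_card _))// card_ord.
move=> /le_trans/(_ far); rewrite ler_pdivlMr// => H.
have H2 : theta / 2 * expR (- g * b) <= expR (- f * b).
  rewrite -(ler_pM2l n_gt0); apply: le_trans H; move: SC; lra.
rewrite ler_pdivlMr ?subr_gt0// -ler_expR lnK ?posrE ?divr_gt0//.
rewrite ler_pdivlMr//.
have -> : b * (f - g) = f * b + (- g * b) by ring.
rewrite expRD.
have e1 : expR (f * b) * expR (- f * b) = 1 by rewrite -expRD mulNr subrr expR0.
have := ler_wpM2l (expR_ge0 (f * b)) H2; rewrite e1.
lra.
Qed.

(** Every kernel value is at most 1, so the normalizer is at most [n]. *)
Lemma pcond_ge (j i : 'I_n) (M Dl : R) : j != i -> 0 <= M ->
  (2 * sig j ^+ 2)^-1 <= M -> sqn (X j) (X i) <= Dl ->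
  expR (- (Dl * M)) / n%:R <= pcond X sig j i.
Proof.
move=> ji M0 bM DD; rewrite /pcond (negbTE ji).
have [sj0 _] := calX j.
have b0 : 0 < (2 * sig j ^+ 2)^-1 by rewrite invr_gt0 mulr_gt0 ?exprn_gt0.
apply: ler_pM.
- exact: expR_ge0.
- by rewrite invr_ge0 ltW.
- rewrite /gk ler_expR mulNr lerN2 ler_pM ?sqn_ge0//; exact: ltW.
have S0 : 0 < \sum_(k < n | k != j) gk (sig j) (X j) (X k).
  by apply: sumr_neq_gt0 => // l; exact: gk_gt0.
rewrite lef_pV2 ?posrE//.
have -> : n%:R = \sum_(k < n) 1 :> R by rewrite sumr_const card_ord.
rewrite big_mkcond /=; apply: ler_sum => k _; case: ifP => // _.
by rewrite /gk -[leRHS]expR0 ler_expR mulNr oppr_le0 mulr_ge0 ?sqn_ge0 ?(ltW b0).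
Qed.

Lemma pjoint_ge (i j : 'I_n) (c : R) : j != i ->
  c / n%:R <= pcond X sig j i -> c / 2 / n%:R ^+ 2 <= pjoint X sig i j.
Proof.
move=> ji cp; rewrite /pjoint eq_sym (negbTE ji) ler_pdivlMr ?mulr_gt0//.
have -> : c / 2 / n%:R ^+ 2 * (2 * n%:R) = c / n%:R.
  by field; exact: lt0r_neq0.
by rewrite ler_wpDr// pcond_ge0.
Qed.

End Bandwidth.

(** * Tail estimates from the balance of attraction and repulsion *)

Section Tails.
Context {R : realType} {s n : nat}.
Variables (p : 'I_n -> 'I_n -> R) (Y : 'I_n -> 'rV[R]_s) (J : {set 'I_n}).
Variables (c theta B : R).
Hypothesis n_ge2 : (2 <= n)%N.
Hypothesis p_ge0 : forall i j, 0 <= p i j.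
Hypothesis contraction : forall h : 'I_n -> 'rV[R]_s,
  (forall i j, 0 <= dotp (Y i - Y j) (h i - h j)) ->
  \sum_(i < n) \sum_(j < n | j != i)
    p i j * (dotp (Y i - Y j) (h i - h j) / (1 + sqn (Y i) (Y j)))
  <= 2 * \sum_(i < n) \sum_(j < n | j != i)
    dotp (Y i - Y j) (h i - h j) / (1 + sqn (Y i) (Y j)) ^+ 2 / Znorm Y.
Hypotheses (c_gt0 : 0 < c) (theta_gt0 : 0 < theta) (B_ge1 : 1 <= B).
Hypothesis J_large : theta * n%:R <= #|J|%:R.
Hypothesis n_large : 2 <= theta * n%:R.
Hypothesis YJ : forall j, j \in J -> sqn (Y j) 0 <= B.
Hypothesis pJ : forall i j, j \in J -> j != i -> c / n%:R ^+ 2 <= p i j.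

Let z := theta ^+ 2 / (2 * (1 + 4 * B)).
Let N i := sqn (Y i) 0.
Let D i j := sqn (Y i) (Y j).

Let n_gt0 : 0 < n%:R :> R.
Proof. by rewrite ltr0n; exact: leq_trans n_ge2. Qed.

Let z_gt0 : 0 < z.
Proof. by rewrite divr_gt0 ?exprn_gt0// mulr_gt0//; move: B_ge1; lra. Qed.

Let D_ge0 i j : 0 <= D i j. Proof. exact: sqn_ge0. Qed.
Let N_ge0 i : 0 <= N i. Proof. exact: sqn_ge0. Qed.

Let ND i j : N i <= 2 * D i j + 2 * N j. Proof. exact: sqn_le2. Qed.

(** Pairs inside [J] suffice: their squared distances are at most [4 * B], and
    [#|J| - 1 >= #|J| / 2] accounts for the missing diagonal. *)
Lemma Znorm_ge : z * n%:R ^+ 2 <= Znorm Y.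
Proof.
have B0 : 0 < 1 + 4 * B by move: B_ge1; lra.
have DJ k l : k \in J -> l \in J -> (1 + 4 * B)^-1 <= (1 + D k l)^-1.
  move=> kJ lJ; rewrite lef_pV2 ?posrE//; last by rewrite ltr_wpDr.
  have := sqn_le2 (Y k) 0 (Y l); rewrite [sqn 0 _]sqnC -/(D k l).
  by have := YJ _ kJ; have := YJ _ lJ; lra.
apply: (@le_trans _ _ (\sum_(k in J) (1 + 4 * B)^-1 * (#|J|%:R - 1))).
  rewrite sumr_const -[leRHS]mulr_natl.
  have J2 : #|J|%:R / 2 <= #|J|%:R - 1 :> R by move: J_large n_large; lra.
  have -> : z * n%:R ^+ 2 = (theta * n%:R) * ((1 + 4 * B)^-1 * (theta * n%:R / 2)).
    by rewrite /z; field; exact: lt0r_neq0.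
  have tn0 : 0 <= theta * n%:R by rewrite mulr_ge0 ?ltW.
  apply: ler_pM => //; first by rewrite mulr_ge0 ?(divr_ge0 tn0)// invr_ge0 ltW.
  rewrite ler_pM2l ?invr_gt0//; move: J_large J2; lra.
rewrite /Znorm [leRHS](bigID (fun k => k \in J)) /= ler_wpDr//.
  by apply: sumr_ge0 => k _; apply: sumr_ge0 => l _; rewrite invr_ge0 ltW// one_sqn_gt0.
apply: ler_sum => k kJ.
apply: (@le_trans _ _ (\sum_(l in J :\ k) (1 + 4 * B)^-1)).
  rewrite sumr_const -[leRHS]mulr_natr (cardsD1 k J) kJ /= natrD.
  by rewrite addrAC subrr add0r.
rewrite [leLHS]big_mkcond [leRHS]big_mkcond /=; apply: ler_sum => l _.
rewrite !inE; case: (l != k) => //=; case: ifP => lJ; first exact: DJ.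
by rewrite invr_ge0 ltW// one_sqn_gt0.
Qed.

(* Test the contraction inequality with the radial field [h i = lam i *: Y i]. *)
Lemma radial_force (lam : 'I_n -> R) (b : 'I_n -> 'I_n -> R) (A : {set 'I_n}) (e : R)
  (E := fun i j => ((lam i - lam j) * (N i - N j) + (lam i + lam j) * D i j) / 2) :
  0 < e -> (forall i j, 0 <= E i j) ->
  (forall i j, 0 <= b i j) ->
  (forall i j, E i j / (1 + D i j) ^+ 2 <= b i j + b j i) ->
  (forall i j, i \in A -> j \in J -> j != i /\ e * (1 + D i j) <= E i j) ->
  c * theta * e * z * n%:R * #|A|%:R <= 4 * \sum_(i < n) \sum_(j < n) b i j.
Proof.
move=> e0 E0 b0 Eb EA.
have EE i j : dotp (Y i - Y j) (lam i *: Y i - lam j *: Y j) = E i j.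
  exact: dotp_scale_diff.
have := contraction (fun i => lam i *: Y i).
have -> : (\sum_(i < n) \sum_(j < n | j != i)
  p i j * (dotp (Y i - Y j) (lam i *: Y i - lam j *: Y j) / (1 + sqn (Y i) (Y j)))) =
   \sum_(i < n) \sum_(j < n | j != i) p i j * (E i j / (1 + D i j)).
  by apply: eq_bigr => i _; apply: eq_bigr => j _; rewrite EE.
have -> : (\sum_(i < n) \sum_(j < n | j != i)
  dotp (Y i - Y j) (lam i *: Y i - lam j *: Y j) / (1 + sqn (Y i) (Y j)) ^+ 2 / Znorm Y) =
   (\sum_(i < n) \sum_(j < n | j != i) E i j / (1 + D i j) ^+ 2) / Znorm Y.
  rewrite mulr_suml; apply: eq_bigr => i _; rewrite mulr_suml.
  by apply: eq_bigr => j _; rewrite EE.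
move=> H; have {H} : _ := H (fun i j => ltac:(rewrite EE; exact: E0)).
have Z0 := Znorm_gt0 n_ge2 Y.
have D1 i j : 0 < 1 + D i j by rewrite ltr_wpDr.
(* The bound [b i j + b j i] is symmetrized, so that [b] need only charge one point of each pair. *)
have up : \sum_(i < n) \sum_(j < n | j != i) E i j / (1 + D i j) ^+ 2
    <= 2 * \sum_(i < n) \sum_(j < n) b i j.
  apply: (@le_trans _ _ (\sum_(i < n) \sum_(j < n) (b i j + b j i))).
    apply: ler_sum => i _; rewrite big_mkcond /=; apply: ler_sum => j _.
    by case: ifP => // _; rewrite addr_ge0.
  under eq_bigr do rewrite big_split /=.
  rewrite big_split /= [X in _ + X]exchange_big /=; lra.
(* Only pairs with [i] in [A] and [j] in [J] are kept; each contributes at least [c * e / n ^ 2]. *)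
have lo : #|A|%:R * (#|J|%:R * (c / n%:R ^+ 2 * e)) <=
    \sum_(i < n) \sum_(j < n | j != i) p i j * (E i j / (1 + D i j)).
  rewrite [leLHS]mulr_natl -sumr_const big_mkcond /=; apply: ler_sum => i _.
  have pE j : 0 <= p i j * (E i j / (1 + D i j)).
    by apply: mulr_ge0; [exact: p_ge0|apply: divr_ge0; [exact: E0|exact/ltW/D1]].
  case: ifP => iA; last exact: sumr_ge0.
  rewrite mulr_natl -sumr_const big_mkcond [leRHS]big_mkcond /=.
  apply: ler_sum => j _; case: ifP => jJ; last by case: ifP.
  have [ji eE] := EA i j iA jJ; rewrite ji.
  apply: ler_pM.
  - by rewrite divr_ge0 ?exprn_ge0 ?(ltW c_gt0).
  - exact: ltW.
  - exact: pJ.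
  - by rewrite ler_pdivlMr.
move=> /(le_trans lo); rewrite [leRHS]mulrA ler_pdivlMr// => H.
have {}H : #|A|%:R * (#|J|%:R * (c / n%:R ^+ 2 * e)) * (z * n%:R ^+ 2)
    <= 4 * \sum_(i < n) \sum_(j < n) b i j.
  apply: (@le_trans _ _ (#|A|%:R * (#|J|%:R * (c / n%:R ^+ 2 * e)) * Znorm Y)).
    apply: ler_wpM2l; last exact: Znorm_ge.
    by rewrite !mulr_ge0 ?invr_ge0 ?exprn_ge0 ?(ltW c_gt0) ?(ltW e0) ?ler0n.
  by apply: (le_trans H); move: up; lra.
apply: le_trans H.
have -> : #|A|%:R * (#|J|%:R * (c / n%:R ^+ 2 * e)) * (z * n%:R ^+ 2) =
  #|J|%:R * (#|A|%:R * c * e * z) by field; exact: lt0r_neq0.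
have -> : c * theta * e * z * n%:R * #|A|%:R = 
  theta * n%:R * (#|A|%:R * c * e * z) by ring.
apply: ler_wpM2r => //; apply: mulr_ge0 (ltW z_gt0).
by rewrite !mulr_ge0 ?(ltW c_gt0) ?(ltW e0).
Qed.

Definition tail (T : R) : R := #|[set i | T <= N i]%SET|%:R / n%:R.

Lemma tail_ge0 T : 0 <= tail T.
Proof. by rewrite divr_ge0. Qed.

Lemma tail_le (T T' : R) : T <= T' -> tail T' <= tail T.
Proof.
move=> TT; rewrite ler_wpM2r ?invr_ge0// ler_nat subset_leq_card//.
by apply/fintype.subsetP => i; rewrite !inE; exact: le_trans.
Qed.

Lemma sum_indic (T a : R) : \sum_(i < n) (if T <= N i then a else 0) = n%:R * tail T * a.
Proof.
rewrite -big_mkcond /= -big_set /= sumr_const /tail mulrC -mulr_natr.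
by field; exact: lt0r_neq0.
Qed.

(** One constant for both estimates below, which come out with 64 and 16 in place of 128. *)
Let K := 128 / (c * theta * z).

Let ctz : 0 < c * theta * z := mulr_gt0 (mulr_gt0 c_gt0 theta_gt0) z_gt0.

Let K_def : c * theta * z * K = 128.
Proof. by rewrite /K mulrC divfK// lt0r_neq0. Qed.

(** The factor [lam] vanishes up to [T] and is at least 3/4 beyond [4 * T]. Points beyond [4 * T]
    therefore feel the full pull of [J], while repulsion is charged only to points beyond [T], and
    is weak unless the partner lies beyond [T / 4]. *)
Lemma tail_recursion (T : R) : B <= T ->
  tail (4 * T) <= K * tail T * (tail (T / 4) + 4 / T).
Proof.
move=> BT; have T1 : 1 <= T by exact: le_trans BT.
have T0 : 0 < T by exact: lt_le_trans T1.
pose lam i := if T <= N i then 1 - T / N i else 0.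
have Npos i : T <= N i -> 0 < N i by exact: lt_le_trans.
have lam_ge0 i : 0 <= lam i.
  by rewrite /lam; case: ifP => // Ti; rewrite subr_ge0 ler_pdivrMr ?Npos// mul1r.
have lam_le1 i : lam i <= 1.
  rewrite /lam; case: ifP => // Ti; rewrite lerBlDr lerDl divr_ge0//.
  exact: ltW.
have lam_mono i j : N j <= N i -> lam j <= lam i.
  move=> ji; rewrite {1}/lam; case: ifP => // Tj; rewrite /lam (le_trans Tj ji).
  rewrite lerD2l lerN2 ler_pM2l// lef_pV2 ?posrE ?Npos//; exact: le_trans ji.
(* In this relative form the Lipschitz bound turns the first term of [E] into the left side of
   [sqn_diff_le], whence [E <= 3 * D]. *)
have lam_lip i j : N j <= N i -> lam i - lam j <= (N i - N j) / N i.
  move=> ji; have [Ti|iT] := leP T (N i); last first.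
    have jT : N j < T by exact: le_lt_trans iT.
    rewrite /lam (lt_geF iT) (lt_geF jT) subrr divr_ge0 ?subr_ge0//.
  have Ni := Npos _ Ti; rewrite {1}/lam Ti /lam; case: ifP => Tj.
    have Nj := Npos _ Tj.
    have -> : 1 - T / N i - (1 - T / N j) = T / N j * ((N i - N j) / N i).
      by field; rewrite !lt0r_neq0.
    rewrite -[leRHS]mul1r ler_wpM2r ?divr_ge0 ?subr_ge0 ?(ltW Ni)//.
    by rewrite ler_pdivrMr// mul1r.
  rewrite subr0 mulrBl divff ?lt0r_neq0// lerD2l lerN2 ler_pM2r ?invr_gt0//.
  by rewrite ltW// ltNge Tj.
pose E i j := ((lam i - lam j) * (N i - N j) + (lam i + lam j) * D i j) / 2.
have E_sym i j : E i j = E j i.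
  by rewrite /E /D sqnC; ring.
have E_ge0 i j : 0 <= E i j.
  wlog ji : i j / N j <= N i.
    by move=> W; case: (leP (N j) (N i)) => [|/ltW] ji; [|rewrite E_sym]; exact: W.
  rewrite divr_ge0// addr_ge0// mulr_ge0 ?subr_ge0 ?lam_mono//.
  by rewrite addr_ge0.
have E_le i j : E i j <= 3 * D i j.
  wlog ji : i j / N j <= N i.
    move=> W; case: (leP (N j) (N i)) => [|/ltW] ji; first exact: W.
    by rewrite E_sym /D sqnC; exact: W.
  have h1 : (lam i - lam j) * (N i - N j) <= 4 * D i j.
    apply: le_trans (sqn_diff_le (Y i) (Y j) ji).
    rewrite -/(N i) -/(N j).
    have -> : (N i - N j) ^+ 2 / N i = (N i - N j) / N i * (N i - N j) by ring.
    by rewrite ler_wpM2r ?subr_ge0// lam_lip.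
  have h2 : (lam i + lam j) * D i j <= 2 * D i j.
    by rewrite ler_wpM2r//; have := lam_le1 i; have := lam_le1 j; lra.
  rewrite /E; lra.
(* If [N j < T / 4] while [T <= N i], then [D >= T / 4] and [D / (1 + D) ^ 2 <= 4 / T]; otherwise
   that quotient is bounded by 1. *)
pose b i j : R := if T <= N i then 3 * ((if T / 4 <= N j then 1 else 0) + 4 / T) else 0.
have b0 i j : 0 <= b i j.
  rewrite /b; case: ifP => // _; rewrite mulr_ge0// addr_ge0 ?divr_ge0 ?(ltW T0)//.
  by case: ifP.
have D1 i j : 0 < 1 + D i j by rewrite ltr_wpDr.
have Eb1 i j : T <= N i -> E i j / (1 + D i j) ^+ 2 <= b i j.
  move=> Ti; rewrite /b Ti ler_pdivrMr ?exprn_gt0//.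
  apply: (le_trans (E_le i j)); rewrite -mulrA ler_pM2l//.
  have := D_ge0 i j; set x := D i j => x0.
  have T40 : 0 < 4 / T by rewrite divr_gt0.
  case: ifP => Tj.
    have := mulr_ge0 (ltW T40) (sqr_ge0 (1 + x)); nra.
  have xT : T / 4 <= x.
    have := ND i j; move: Tj => /negbT; rewrite -ltNge -/x; move: Ti; lra.
  have e1 : 4 / T * (T / 4) = 1 by field; exact: lt0r_neq0.
  have x1 : 1 <= 4 / T * x by rewrite -[leLHS]e1 ler_pM2l.
  have : 0 <= (4 / T * x - 1) * x by rewrite mulr_ge0// subr_ge0.
  nra.
have Eb i j : E i j / (1 + D i j) ^+ 2 <= b i j + b j i.
  have [Ti|iT] := leP T (N i); first by rewrite ler_wpDr// Eb1.
  have [Tj|jT] := leP T (N j); first by rewrite ler_wpDl// E_sym /D sqnC Eb1.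
  rewrite /E /lam (lt_geF iT) (lt_geF jT) /= subrr mul0r !add0r mul0r mul0r mul0r.
  exact: addr_ge0.
(* Here [D >= T >= 1] and [lam i >= 3 / 4], so [E >= 3 * D / 8 >= 3 * (1 + D) / 16]. *)
have EA i j : i \in [set i | 4 * T <= N i]%SET -> j \in J ->
    j != i /\ 3 / 16 * (1 + D i j) <= E i j.
  rewrite inE => Ti jJ; have Bj : N j <= B by exact: YJ.
  split; first by apply/eqP => ji; move: Ti Bj BT; rewrite ji; lra.
  have xT : T <= D i j by have := ND i j; move: Ti Bj BT; lra.
  have li : 3 / 4 <= lam i.
    rewrite /lam ifT; last by move: Ti T0; lra.
    have Ni : 0 < N i by move: Ti T0; lra.
    have : T / N i <= 1 / 4 by rewrite ler_pdivrMr//; move: Ti; lra.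
    lra.
  have lj := lam_ge0 j.
  have ij : N j <= N i by move: Ti Bj BT T0; lra.
  have h1 : 0 <= (lam i - lam j) * (N i - N j) by rewrite mulr_ge0 ?subr_ge0 ?lam_mono.
  have h2 : 3 / 4 * D i j <= (lam i + lam j) * D i j by rewrite ler_wpM2r//; lra.
  rewrite /E; move: xT T1; lra.
have e0 : 0 < 3 / 16 :> R by lra.
have := radial_force lam b _ _ e0 E_ge0 b0 Eb EA.
have -> : \sum_(i < n) \sum_(j < n) b i j =
    n%:R * tail T * (3 * n%:R * (tail (T / 4) + 4 / T)).
  rewrite -sum_indic; apply: eq_bigr => i _; rewrite /b; case: ifP => _.
    rewrite -mulr_sumr big_split /= sum_indic sumr_const card_ord -mulr_natl; ring.
  exact: big1.
have -> : #|[set i | 4 * T <= N i]%SET|%:R = n%:R * tail (4 * T).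
  by rewrite /tail; field; exact: lt0r_neq0.
move=> H.
have {}H : c * theta * z * tail (4 * T) <= 64 * tail T * (tail (T / 4) + 4 / T).
  have n2 : 0 < n%:R ^+ 2 * (3 / 16) :> R by rewrite mulr_gt0 ?exprn_gt0.
  rewrite -(ler_pM2l n2); move: H; nra.
rewrite -(ler_pM2l ctz); apply: (le_trans H).
have -> : c * theta * z * (K * tail T * (tail (T / 4) + 4 / T)) =
   128 * tail T * (tail (T / 4) + 4 / T) by rewrite -K_def; ring.
rewrite ler_wpM2r ?ler_wpM2r ?tail_ge0 ?ler_nat//.
by rewrite addr_ge0 ?tail_ge0// divr_ge0 ?ltW.
Qed.

(* At an outermost point every pair force points inwards. *)
Lemma outermost_bound (i0 : 'I_n) : (forall j, N j <= N i0) -> 2 * B + 2 <= N i0 ->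
  1 <= K * ((N i0 + 1) * tail (N i0 / 4) + 20 / N i0).
Proof.
move=> imax N0B; set M := N i0 in imax N0B *.
have M0 : 0 < M by move: B_ge1 N0B; lra.
pose lam i : R := if i == i0 then 1 else 0.
pose E i j := ((lam i - lam j) * (N i - N j) + (lam i + lam j) * D i j) / 2.
(* The force is at most [(M + D) / (1 + D) ^ 2], hence at most [M + 1]. If [N j < M / 4] then
   [D >= M / 4], and it is at most [5 / D <= 20 / M]. *)
pose b i j : R := if i == i0 then
   (M + 1) * (if M / 4 <= N j then 1 else 0) + 20 / M else 0.
have b0 i j : 0 <= b i j.
  rewrite /b; case: ifP => // _; rewrite addr_ge0 ?divr_ge0 ?(ltW M0)//.
  by rewrite mulr_ge0 ?addr_ge0 ?(ltW M0)//; case: ifP.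
have E_sym i j : E i j = E j i by rewrite /E /D sqnC; ring.
have E0 i j : 0 <= E i j.
  rewrite /E /lam; have := D_ge0 i j; have := imax i; have := imax j.
  case: (eqVneq i i0) => [->|_]; case: (eqVneq j i0) => [->|_]; rewrite -/M; lra.
have D1 i j : 0 < 1 + D i j by rewrite ltr_wpDr.
have Eb1 j : E i0 j / (1 + D i0 j) ^+ 2 <= b i0 j.
  rewrite /b eqxx ler_pdivrMr ?exprn_gt0// -/M.
  have E1 : E i0 j <= M + D i0 j.
    rewrite /E /lam eqxx; have := D_ge0 i0 j; have := N_ge0 j.
    by case: (eqVneq j i0) => [->|_]; rewrite -/M; move: M0; lra.
  apply: (le_trans E1); have := ND i0 j; have := D_ge0 i0 j.
  set x := D i0 j => x0; rewrite -/M => Mx.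
  have M20 : 0 < 20 / M by rewrite divr_gt0.
  case: ifP => Mj.
    rewrite mulr1; have := mulr_ge0 (ltW M20) (sqr_ge0 (1 + x)).
    have : 0 <= M * x by rewrite mulr_ge0// ltW.
    have : 0 <= M * x ^+ 2 by rewrite mulr_ge0 ?sqr_ge0// ltW.
    nra.
  rewrite mulr0 add0r.
  have xM : M / 4 <= x by move: Mj => /negbT; rewrite -ltNge; lra.
  have e5 : 20 / M * (M / 4) = 5 by field; exact: lt0r_neq0.
  have M5 : 5 <= 20 / M * x by rewrite -[leLHS]e5 ler_pM2l.
  have : 0 <= (20 / M * x - 5) * x by rewrite mulr_ge0// subr_ge0.
  nra.
have Eb i j : E i j / (1 + D i j) ^+ 2 <= b i j + b j i.
  case: (eqVneq i i0) => [->|ii0]; first by rewrite ler_wpDr// Eb1.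
  case: (eqVneq j i0) => [->|ji0]; first by rewrite ler_wpDl// E_sym /D sqnC Eb1.
  rewrite /E /lam (negbTE ii0) (negbTE ji0) /= subrr mul0r !add0r mul0r mul0r mul0r.
  exact: addr_ge0.
(* The assumption [2 * B + 2 <= M] yields [D >= 1], so that [E >= D / 2 >= (1 + D) / 4]. *)
have EA i j : i \in [set i0]%SET -> j \in J -> j != i /\ 4^-1 * (1 + D i j) <= E i j.
  rewrite inE => /eqP -> jJ; have Bj : N j <= B by exact: YJ.
  have ji0 : j != i0.
    by apply/eqP => ji; move: N0B Bj B_ge1; rewrite ji -/M; lra.
  split=> //; have := ND i0 j; rewrite -/M /E /lam eqxx (negbTE ji0) -/M.
  have := imax j; move: N0B Bj B_ge1; lra.
have e0 : 0 < 4^-1 :> R by lra.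
have := radial_force lam b _ _ e0 E0 b0 Eb EA.
have -> : \sum_(i < n) \sum_(j < n) b i j =
    n%:R * ((M + 1) * tail (M / 4) + 20 / M).
  rewrite (bigD1 i0) //= [X in _ + X]big1 ?addr0; last first.
    by move=> i ii0; apply: big1 => j _; rewrite /b (negbTE ii0).
  rewrite /b eqxx big_split /= -mulr_sumr sum_indic sumr_const card_ord -mulr_natl; ring.
rewrite cards1 => H.
have {}H : c * theta * z <= 16 * ((M + 1) * tail (M / 4) + 20 / M).
  by rewrite -(ler_pM2l n_gt0); move: H; lra.
rewrite -(ler_pM2l ctz) mulr1; apply: (le_trans H).
have -> : c * theta * z * (K * ((M + 1) * tail (M / 4) + 20 / M)) =
   128 * ((M + 1) * tail (M / 4) + 20 / M) by rewrite -K_def; ring.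
rewrite ler_wpM2r ?ler_nat//.
by rewrite addr_ge0 ?divr_ge0 ?mulr_ge0 ?tail_ge0 ?addr_ge0 ?(ltW M0).
Qed.

End Tails.

(** * A bound on the embedding that is uniform in the number of points *)

Lemma tail_le1 {R : realType} {s n : nat} (Y : 'I_n -> 'rV[R]_s) (T : R) :
  (2 <= n)%N -> tail Y T <= 1.
Proof.
move=> n2; have n0 : 0 < n%:R :> R by rewrite ltr0n; exact: leq_trans n2.
by rewrite /tail ler_pdivrMr// mul1r ler_nat (leq_trans (max_card _))// card_ord.
Qed.

(** The order of quantifiers is the point: [eps] depends on [c], [theta], [B] alone, so tightness
    can afterwards supply a [T0] for this [eps], and the resulting [T1] serves all sample sizes and
    embeddings at once. *)
Lemma uniform_bound {R : realType} (c theta B : R) :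
  0 < c -> 0 < theta -> 1 <= B ->
  exists2 eps : R, 0 < eps & forall T0 : R, exists T1 : R,
  forall (s n : nat) (p : 'I_n -> 'I_n -> R) (Y : 'I_n -> 'rV[R]_s) (J : {set 'I_n}),
  (2 <= n)%N ->
  (forall i j, 0 <= p i j) ->
  (forall h : 'I_n -> 'rV[R]_s,
    (forall i j, 0 <= dotp (Y i - Y j) (h i - h j)) ->
    \sum_(i < n) \sum_(j < n | j != i)
      p i j * (dotp (Y i - Y j) (h i - h j) / (1 + sqn (Y i) (Y j)))
    <= 2 * \sum_(i < n) \sum_(j < n | j != i)
      dotp (Y i - Y j) (h i - h j) / (1 + sqn (Y i) (Y j)) ^+ 2 / Znorm Y) ->
  theta * n%:R <= #|J|%:R ->
  2 <= theta * n%:R ->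
  (forall j, j \in J -> sqn (Y j) 0 <= B) ->
  (forall i j, j \in J -> j != i -> c / n%:R ^+ 2 <= p i j) ->
  tail Y T0 <= eps -> forall i, sqn (Y i) 0 <= T1.
Proof.
move=> c0 th0 B1.
set K := 128 / (c * theta * (theta ^+ 2 / (2 * (1 + 4 * B)))).
have K0 : 0 < K.
  apply: divr_gt0 => //; apply: mulr_gt0; first exact: mulr_gt0.
  by apply: divr_gt0; [exact: exprn_gt0|move: B1; lra].
have eps0 : 0 < (32 * K)^-1 by rewrite invr_gt0 mulr_gt0.
(* With this choice [K * (2 * eps) = 1 / 16]: each step of the recursion multiplies the threshold by
   4 and divides the tail by 16, which is quadratic decay. *)
exists (32 * K)^-1 => // T0.
set eps := (32 * K)^-1 in eps0 *.
have Keps : K * (2 * eps) = 16^-1 by rewrite /eps; field; exact: lt0r_neq0.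
clearbody eps.
(* For [T >= Tb] the recursion applies and both [tail Y (T / 4)] and [4 / T] are at most [eps]. *)
pose Tb := Num.max B (Num.max (4 * T0) (4 / eps)).
have BTb : B <= Tb by rewrite le_max lexx.
have T0Tb : 4 * T0 <= Tb by rewrite !le_max lexx orbT.
have eTb : 4 / eps <= Tb by rewrite !le_max lexx !orbT.
clearbody Tb.
have Tb1 : 1 <= Tb by exact: le_trans BTb.
(* A larger maximum [M] would meet the requirement of [sq], then that of [outermost_bound], and
   finally exceed [K * (512 * Tb ^ 2 + 20)], contradicting the latter. *)
exists (4 * Tb + (2 * B + 2) + K * (512 * Tb ^+ 2 + 20)).
move=> s n p Y J n2 p0 contr Jl nl YJ pJ small.
have rec := tail_recursion p Y J c theta B n2 p0 contr c0 th0 B1 Jl nl YJ pJ.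
have out := outermost_bound p Y J c theta B n2 p0 contr c0 th0 B1 Jl nl YJ pJ.
rewrite -/K in rec out.
have geo k : tail Y (4 ^+ k * Tb) <= 16^-1 ^+ k.
  elim: k => [|k IH]; first by rewrite !expr0 tail_le1.
  have k1 : 1 <= 4 ^+ k :> R by rewrite exprn_ege1// ler1n.
  have TT : Tb <= 4 ^+ k * Tb by rewrite ler_peMl//; move: Tb1; lra.
  have := rec (4 ^+ k * Tb) (le_trans BTb TT).
  rewrite mulrA -exprS => /le_trans; apply.
  set T := 4 ^+ k * Tb in TT IH *.
  have T0' : 0 < T by move: Tb1 TT; lra.
  have h1 : tail Y (T / 4) <= eps.
    by apply: le_trans small; apply: tail_le; move: T0Tb TT; lra.
  have h2 : 4 / T <= eps.
    by move: (le_trans eTb TT); rewrite !ler_pdivrMr// mulrC.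
  have -> : 16^-1 ^+ k.+1 = K * (16^-1 ^+ k * (2 * eps)).
    by rewrite exprSr mulrCA Keps.
  rewrite -mulrA ler_pM2l//.
  apply: ler_pM => //; first exact: tail_ge0.
    by rewrite addr_ge0 ?tail_ge0// divr_ge0 ?ltW.
  by move: h1 h2; lra.
(* Induction on the scale of [M]. Up to [16 * Tb] the tail is simply at most 1; at a new scale
   [M / 4 >= 4 ^ (k + 1) * Tb], and the [16 ^ - (k + 1)] from [geo] cancels the growth of
   [M ^ 2]. *)
have sq k M : 4 * Tb <= M -> M <= 4 ^+ k.+2 * Tb ->
    tail Y (M / 4) * M ^+ 2 <= 256 * Tb ^+ 2.
  move=> Mlo; have M0 : 0 <= M by move: Tb1 Mlo; lra.
  elim: k => [|k IH] Mhi.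
    have : tail Y (M / 4) * M ^+ 2 <= 1 * (16 * Tb) ^+ 2.
      apply: ler_pM; rewrite ?tail_ge0 ?sqr_ge0 ?tail_le1//.
      by rewrite lerXn2r ?nnegrE//; move: Mhi Tb1; rewrite !exprS expr0; lra.
    by rewrite exprMn; lra.
  have [/IH//|/ltW Mk] := leP M (4 ^+ k.+2 * Tb).
  have h1 : tail Y (M / 4) <= 16^-1 ^+ k.+1.
    apply: le_trans (geo k.+1); apply: tail_le; move: Mk.
    by rewrite exprS; lra.
  have h2 : M ^+ 2 <= (4 ^+ k.+3 * Tb) ^+ 2.
    by rewrite lerXn2r ?nnegrE// (le_trans M0).
  have := ler_pM (tail_ge0 Y (M / 4)) (sqr_ge0 M) h1 h2.
  move=> /le_trans; apply.
  have e16 : 16^-1 ^+ k.+1 * (4 ^+ k.+1) ^+ 2 = 1 :> R.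
    rewrite exprAC -exprMn (_ : 4 ^+ 2 = 16 :> R); last by ring.
    by rewrite mulVf ?expr1n// pnatr_eq0.
  have -> : 16^-1 ^+ k.+1 * (4 ^+ k.+3 * Tb) ^+ 2 =
     16^-1 ^+ k.+1 * (4 ^+ k.+1) ^+ 2 * (256 * Tb ^+ 2).
    by rewrite (exprS 4 k.+2) (exprS 4 k.+1); ring.
  by rewrite e16 mul1r.
have i0 : 'I_n by exact: (Ordinal n2).
have [im _ immax] := @arg_maxP _ _ 'I_n i0 xpredT (fun i => sqn (Y i) 0) isT.
suff Mle : sqn (Y im) 0 <= 4 * Tb + (2 * B + 2) + K * (512 * Tb ^+ 2 + 20).
  by move=> i; apply: le_trans Mle; exact: immax.
set M := sqn (Y im) 0; rewrite leNgt; apply/negP => Mbig.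
have Q0 : 0 <= K * (512 * Tb ^+ 2 + 20).
  by rewrite mulr_ge0 ?(ltW K0)// addr_ge0// mulr_ge0// sqr_ge0.
have M1 : 1 <= M by move: Mbig Q0 Tb1 B1; lra.
have M0 : 0 < M by exact: lt_le_trans M1.
have := out im (fun j => immax j isT); rewrite -/M.
have -> : (2 * B + 2 <= M) by move: Mbig Q0 Tb1 B1; lra.
move=> /(_ isT); apply/negP; rewrite -ltNge.
have [k Mk] : exists k, M <= 4 ^+ k.+2 * Tb.
  exists (Num.bound M); have := archi_boundP (ltW M0) => /ltW /le_trans; apply.
  have b4 : (Num.bound M)%:R <= 4 ^+ (Num.bound M).+2 :> R.
    rewrite -natrX ler_nat; apply: ltnW; apply: (ltn_trans (ltn_expl _ (_ : 1 < 4)%N)) => //.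
    by rewrite ltn_exp2l.
  apply: (le_trans b4); rewrite ler_peMr// exprn_ge0//.
have := sq k M; have -> : 4 * Tb <= M by move: Mbig Q0 Tb1 B1; lra.
move=> /(_ isT Mk) tM.
have t0 := tail_ge0 Y (M / 4).
(* As [M + 1 <= 2 * M], the quadratic decay beats the linear factor of [outermost_bound]. *)
have tM' : (M + 1) * tail Y (M / 4) <= 512 * Tb ^+ 2 / M.
  rewrite ler_pdivlMr//.
  have : (M + 1) * tail Y (M / 4) * M <= 2 * M * tail Y (M / 4) * M.
    by rewrite ler_pM2r// ler_wpM2r//; move: M1; lra.
  move: tM; nra.
apply: (@le_lt_trans _ _ (K * (512 * Tb ^+ 2 / M + 20 / M))).
  by rewrite ler_pM2l// lerD2r.
rewrite -mulrDl mulrA ltr_pdivrMr// mul1r; move: Mbig Tb1 B1; lra.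
Qed.

(** * Frequencies of level sets under weak convergence *)

Section WeakConvergence.
Context {R : realType} {T : ptopologicalType}.

Lemma open_borel (U : set T) : open U -> measurable (U : set (borel_type T)).
Proof. exact: sub_sigma_algebra. Qed.

Lemma continuous_borel (f : T -> R) :
  continuous f -> measurable_fun setT (f : borel_type T -> R).
Proof.
move=> /continuousP cf; apply: (measurability _ (RGenOpens.measurableE R)).
move=> _ [_ [a [b ->] <-]]; rewrite setTI; apply: open_borel.
by apply: cf; exact: interval_open.
Qed.

Lemma open_gt_continuous (g : T -> R) (a : R) : continuous g -> open [set z | a < g z].
Proof.
move=> cg; rewrite -[X in open X]/(g @^-1` [set r | a < r]).
by move/continuousP : cg; apply; exact: open_gt.
Qed.

Lemma borel_gt (g : T -> R) (a : R) : continuous g ->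
  measurable ([set z | a < g z] : set (borel_type T)).
Proof. by move=> cg; apply: open_borel; exact: open_gt_continuous. Qed.

Lemma borel_ge (g : T -> R) (b : R) : continuous g ->
  measurable ([set z | b <= g z] : set (borel_type T)).
Proof.
move=> /continuousP cg.
rewrite (_ : mkset _ = ~` (g @^-1` [set r | r < b])); last first.
  by apply/seteqP; split => z /=; rewrite leNgt => /negP.
by apply: measurableC; apply: open_borel; apply: cg; exact: open_lt.
Qed.

Lemma integral_empirical (n : nat) (Z : nat -> borel_type T) (f : T -> R) :
  measurable_fun setT (f : borel_type T -> R) -> (forall z, 0 <= f z) ->
  (\int[@empirical R T n Z]_z (f z)%:E)%E = ((\sum_(i < n) f (Z i)) / n%:R)%:E.
Proof.
move=> mf f0; have mf' : measurable_fun setT (fun z : borel_type T => (f z)%:E).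
  exact/measurable_EFinP.
rewrite /empirical ge0_integral_mscale//; last by move=> z _; rewrite lee_fin.
rewrite ge0_integral_measure_sum//; last by move=> z _; rewrite lee_fin.
under eq_bigr do rewrite integral_dirac// diracT mul1e.
by rewrite sumEFin -EFinM mulrC.
Qed.

(** For [a < b], the ramp that is 0 up to [a] and 1 from [b] on: a continuous bounded substitute for
    an indicator. *)
Definition clamp (a b x : R) : R := Num.min 1 (Num.max 0 ((x - a) / (b - a))).

Lemma clamp_ge0 a b x : 0 <= clamp a b x.
Proof. by rewrite /clamp le_min ler01 le_max lexx. Qed.

Lemma clamp_le1 a b x : clamp a b x <= 1.
Proof. by rewrite /clamp ge_min lexx. Qed.

Lemma clamp_eq1 a b x : a < b -> b <= x -> clamp a b x = 1.
Proof.
move=> ab bx; apply/min_idPl; rewrite le_max; apply/orP; right.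
by rewrite ler_pdivlMr ?subr_gt0// mul1r lerD2r.
Qed.

Lemma clamp_eq0 a b x : a < b -> x <= a -> clamp a b x = 0.
Proof.
move=> ab xa; rewrite /clamp (max_idPl _) ?min_r//.
by rewrite ler_pdivrMr ?subr_gt0// mul0r subr_le0.
Qed.

Lemma clamp_continuous (g : T -> R) a b : continuous g -> continuous (clamp a b \o g).
Proof.
move=> cg x; apply: (@continuous_min _ _ (fun=> 1) _ x); first exact: cst_continuous.
apply: (@continuous_max _ _ (fun=> 0) _ x); first exact: cst_continuous.
apply: (@continuousM _ _ (fun z => g z - a) (fun=> (b - a)^-1)); last exact: cst_continuous.
by apply: continuousB; [exact: cg|exact: cst_continuous].
Qed.

Variables (mus_n : nat -> nat) (Z : nat -> nat -> borel_type T).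
Variable mu : {measure set (borel_type T) -> \bar R}.
Hypothesis cvg_mu : weak_cvg (fun k => @empirical R T (mus_n k) (Z k)) mu.
Hypothesis n_gt0 : forall k, (0 < mus_n k)%N.
Variables (g : T -> R) (a b : R).
Hypotheses (cg : continuous g) (ab : a < b).

Let psi z := clamp a b (g z).
Let mpsi : measurable_fun setT (psi : borel_type T -> R).
Proof. exact: (continuous_borel _ (clamp_continuous _ _ _ cg)). Qed.

Let cvg_psi : (fun k => ((\sum_(i < mus_n k) psi (Z k i)) / (mus_n k)%:R)%:E) @ \oo
  --> (\int[mu]_z (psi z)%:E)%E.
Proof.
have := cvg_mu psi (clamp_continuous _ _ _ cg).
have bdd : exists M : R, forall z, `|psi z| <= M.
  exists 1 => z; have psi0 : 0 <= psi z by exact: clamp_ge0.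
  by rewrite ger0_norm//; exact: clamp_le1.
move=> /(_ bdd); apply: cvg_trans; apply: near_eq_cvg; near=> k.
by rewrite integral_empirical// => z; exact: clamp_ge0.
Unshelve. all: by end_near. Qed.

Let measurable_gt := borel_gt g a cg.
Let measurable_ge := borel_ge g b cg.

Let mindic (A : set (borel_type T)) : measurable A ->
  measurable_fun setT (EFin \o (\1_A : borel_type T -> R)).
Proof. by move=> mA; apply/measurable_EFinP; exact: measurable_indic. Qed.

(** The ramp of [g] lies between the indicators of [b <= g] and [a < g]. The gap between [a] and [b]
    spares any condition on the boundaries of the level sets. *)
Lemma weak_cvg_freq_lt (c : R) : (mu [set z | (a < g z)%R] < c%:E)%E ->
  \forall k \near \oo,
    #|[set i : 'I_(mus_n k) | b <= g (Z k i)]%SET|%:R < c * (mus_n k)%:R.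
Proof.
move=> muc.
have : (\int[mu]_z (psi z)%:E < c%:E)%E.
  apply: le_lt_trans muc.
  rewrite -[X in (_ <= mu X)%E]setIT -integral_indic//.
  apply: ge0_le_integral => //.
  - by move=> z _; rewrite lee_fin clamp_ge0.
  - exact/measurable_EFinP.
  - exact: mindic.
  move=> z _; rewrite lee_fin indicE /psi; have [za|az] := leP (g z) a.
    by rewrite clamp_eq0.
  by rewrite mem_set// clamp_le1.
move=> /(@open_ereal_lt' R) nb.
have : \forall k \near \oo,
    (((\sum_(i < mus_n k) psi (Z k i)) / (mus_n k)%:R)%:E < c%:E)%E by exact: cvg_psi nb.
apply: filterS => k.
rewrite lte_fin ltr_pdivrMr ?ltr0n//; apply: le_lt_trans.
rewrite -sumr_const big_mkcond /=; apply: ler_sum => i _.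
rewrite inE; case: ifP => [bz|_]; last exact: clamp_ge0.
by rewrite /psi clamp_eq1.
Qed.

(** The same sandwich, with the roles of the limit measure and of the empirical measures
    exchanged. *)
Lemma weak_cvg_freq_gt (c : R) : (c%:E < mu [set z | (b <= g z)%R])%E ->
  \forall k \near \oo,
    c * (mus_n k)%:R < #|[set i : 'I_(mus_n k) | a < g (Z k i)]%SET|%:R.
Proof.
move=> muc.
have : (c%:E < \int[mu]_z (psi z)%:E)%E.
  apply: (lt_le_trans muc).
  rewrite -[X in (mu X <= _)%E]setIT -integral_indic//.
  apply: ge0_le_integral => //.
  - exact: mindic.
  - exact/measurable_EFinP.
  move=> z _; rewrite lee_fin indicE /psi; have [bz|zb] := leP b (g z).
    by rewrite mem_set// clamp_eq1.
  by rewrite memNset ?clamp_ge0//= leNgt zb.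
move=> /(@open_ereal_gt' R) nb.
have : \forall k \near \oo,
    (c%:E < ((\sum_(i < mus_n k) psi (Z k i)) / (mus_n k)%:R)%:E)%E by exact: cvg_psi nb.
apply: filterS => k.
rewrite lte_fin ltr_pdivlMr ?ltr0n// => /lt_le_trans; apply.
rewrite -sumr_const [leRHS]big_mkcond /=; apply: ler_sum => i _.
rewrite inE; case: ifP => [_|/negbT]; first exact: clamp_le1.
by rewrite -leNgt => za; rewrite /psi clamp_eq0.
Qed.

End WeakConvergence.

(** * Squared distance and the topology of row vectors *)

Section SqnTopology.
Context {R : realType} {k : nat}.
Implicit Types x y : 'rV[R]_k.

Lemma sqn_continuous y : continuous (fun x => sqn x y).
Proof.
apply: continuous_big => [|i _ x]; first exact: add_continuous.
have cx : {for x, continuous (fun x => x 0 i - y 0 i)}.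
  by apply: continuousB; [exact: coord_continuous|exact: cst_continuous].
exact: (continuousM cx cx).
Qed.

Lemma coord_sqr_le_sqn x y i : (x 0 i - y 0 i) ^+ 2 <= sqn x y.
Proof.
by rewrite /sqn (bigD1 i)//= lerDl sumr_ge0// => j _; exact: sqr_ge0.
Qed.

(** Balls of row vectors are coordinatewise, and each squared coordinate difference is at most
    [sqn]; hence the radius [e ^ 2]. *)
Lemma nbhs_sqn x (U : set 'rV[R]_k) : nbhs x U ->
  exists2 e : R, 0 < e & [set y | sqn x y < e] `<=` U.
Proof.
move=> /nbhs_ballP[e e0 eU]; exists (e ^+ 2); first exact: exprn_gt0.
move=> y /= xy; apply: eU; split => // i j; rewrite ord1 /ball /=.
have := le_lt_trans (coord_sqr_le_sqn x y j) xy.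
by rewrite -[X in X < _]real_normK ?num_real// ltr_pXn2r// nnegrE ltW.
Qed.

End SqnTopology.

(** * A countable family of balls, and the support of a measure *)

Section RationalBalls.
Context {R : realType} {d : nat}.
Implicit Types x y : 'rV[R]_d.

(** The index type is countable, so an almost sure property can be secured for all these balls
    together. The radius bounds the squared distance. *)
Definition qball (i : 'rV[rat]_d * nat) : set 'rV[R]_d :=
  [set x | sqn x (map_mx ratr i.1) < i.2.+1%:R^-1].

Lemma sqn_ball_open y (e : R) : open [set x | sqn x y < e].
Proof.
rewrite -[X in open X]/((fun x => sqn x y) @^-1` [set r | r < e]).
by have /continuousP := sqn_continuous y; apply; exact: open_lt.
Qed.

Lemma qball_measurable i : measurable (qball i : set (borel_type 'rV[R]_d)).
Proof. exact: (open_borel _ (sqn_ball_open _ _)). Qed.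

Lemma qball_nbhs x (e : R) : 0 < e ->
  exists2 i, qball i x & forall y, qball i y -> sqn x y < e.
Proof.
move=> e0; set k := Num.bound (4 / e).
have ke : 4 / k.+1%:R < e.
  have : 4 / e < k.+1%:R.
    rewrite (lt_le_trans (archi_boundP _)) ?divr_ge0 ?(ltW e0)//.
    by rewrite ler_nat.
  by rewrite !ltr_pdivrMr// mulrC.
(* Since [dl <= 1], the [d] squared errors add up to at most [d * dl], which is below the radius of
   the ball. *)
set dl : R := (k.+1%:R * d.+1%:R)^-1.
have dl0 : 0 < dl by rewrite invr_gt0 mulr_gt0.
have dl1 : dl <= 1.
  by rewrite invf_le1 ?mulr_gt0// -natrM ler1n muln_gt0.
have /choice[q qP] : forall j, exists q : rat, `|x 0 j - ratr q| < dl.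
  move=> j; have /rat_in_itvoo[q] : x 0 j - dl < x 0 j + dl by lra.
  rewrite in_itv /= => /andP[h1 h2]; exists q.
  by rewrite ltr_norml; apply/andP; split; lra.
have hx : sqn x (map_mx ratr (\row_j q j)) < k.+1%:R^-1.
  apply: (@le_lt_trans _ _ (\sum_(j < d) dl)).
    apply: ler_sum => j _; rewrite !mxE -real_normK ?num_real// expr2.
    have /ltW h := qP j; rewrite (le_trans (ler_pM _ _ h h))//.
    by rewrite ger_pMl.
  have -> : \sum_(j < d) dl = d%:R * dl by rewrite sumr_const card_ord mulr_natl.
  rewrite /dl invfM mulrCA gtr_pMr ?invr_gt0//.
  by rewrite ltr_pdivrMr// mul1r ltr_nat.
exists (\row_j q j, k) => //.
move=> y; rewrite /qball /= => h.
have := sqn_le2 x (map_mx ratr (\row_j q j)) y.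
rewrite [sqn (map_mx _ _) y]sqnC.
move: (k.+1%:R^-1) hx h ke => r; lra.
Qed.

Variable mu : probability (borel_type 'rV[R]_d) R.

(** A point off the support has a null open neighbourhood, hence lies in a null rational ball, and
    there are countably many of these. *)
Lemma msupport_negligible : mu.-negligible (~` msupport mu).
Proof.
pose F n : set (borel_type 'rV[R]_d) :=
  if unpickle n is Some i then
    if `[< mu (qball i) = 0%E >] then qball i else set0 else set0.
apply: (@negligibleS _ _ _ _ (\bigcup_n F n)); last first.
  apply: negligible_bigcup => n; rewrite /F.
  case: unpickle => [i|]; last exact: negligible_set0.
  case: asboolP => [i0|_]; last exact: negligible_set0.
  by apply/negligibleP => //; exact: qball_measurable.
move=> x; rewrite /= /msupport /= => /existsNP[U /not_implyP[oU /not_implyP[Ux]]].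
move=> /negP; rewrite -leNgt => U0.
have [e e0 eU] := @nbhs_sqn _ _ x U (open_nbhs_nbhs (conj oU Ux)).
have [i ix iU] := qball_nbhs x e e0.
exists (pickle i) => //; rewrite /F pickleK.
case: asboolP => // ni; exfalso; apply: ni; apply/eqP; rewrite -measure_le0.
apply: le_trans U0; apply: le_measure; rewrite ?inE.
- exact: qball_measurable.
- exact: open_borel.
by move=> y /iU /eU.
Qed.

(** Continuity from above along balls shrinking to [x], followed by a rational ball inside a small
    one. *)
Lemma small_qball x (e : R) : mu [set x] = 0%E -> 0 < e ->
  exists2 i, qball i x & (mu (qball i) < e%:E)%E.
Proof.
move=> x0 e0.
pose B n : set (borel_type 'rV[R]_d) := [set y | sqn y x < n.+1%:R^-1].
have mB n : measurable (B n) by exact: (open_borel _ (sqn_ball_open _ _)).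
have Bx : \bigcap_n B n = [set x].
  apply/seteqP; split => [y By|y -> n _]; last by rewrite /B /= sqnn invr_gt0.
  have yx0 : sqn y x <= 0.
    apply/ler_addgt0Pr => r r0; rewrite add0r ltW// (lt_trans (By (Num.bound r^-1) I))//.
    rewrite invf_plt ?posrE// (lt_le_trans (archi_boundP _)) ?invr_ge0 ?(ltW r0)//.
    by rewrite ler_nat.
  apply/rowP => j; apply/eqP; rewrite -subr_eq0 -sqrf_eq0.
  by rewrite eq_le sqr_ge0 (le_trans (coord_sqr_le_sqn _ _ _) yx0).
have muB : mu (\bigcap_n B n) = 0%E by rewrite Bx.
have : (mu \o B) x @[x --> \oo] --> 0%E.
  rewrite -muB; apply: nonincreasing_cvg_mu => //.
  - by rewrite (le_lt_trans (probability_le1 _ _))// ltry.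
  - exact: bigcapT_measurable.
  - move=> n m nm; apply/subsetPset => y; rewrite /B /= => /lt_le_trans; apply.
    by rewrite lef_pV2 ?posrE// ler_nat.
have nb : ereal_nbhs 0%E (fun u : \bar R => (u < e%:E)%E).
  by apply: open_ereal_lt'; rewrite lte_fin.
move=> /(_ _ nb) [n _ /(_ n (leqnn n)) /= Bn].
have [|i ix iB] := qball_nbhs x n.+1%:R^-1; first by rewrite invr_gt0.
exists i => //; apply: le_lt_trans Bn; apply: le_measure; rewrite ?inE//.
  exact: qball_measurable.
by move=> y /iB; rewrite /B /= sqnC.
Qed.

End RationalBalls.

(** * Absence of atoms *)

Section Atoms.
Context {R : realType}.

Lemma lebint0 (d : nat) : lebint (fun _ : 'rV[R]_d => 0%E) = 0%E.
Proof.
elim: d => //= d IH; rewrite -[RHS](integral0 lebesgue_measure setT).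
by apply: eq_integral => t _; rewrite IH.
Qed.

(** In the outermost integral of [lebint] the integrand vanishes unless [t] is the first coordinate
    of [x], and a single [t] is Lebesgue null. *)
Lemma density_no_atom (d : nat) (mu : set (borel_type 'rV[R]_d.+1) -> \bar R)
  (f : 'rV[R]_d.+1 -> R) (x : 'rV[R]_d.+1) :
  has_density mu f -> mu [set x] = 0%E.
Proof.
move=> [_ ->]; last first.
  rewrite -[X in measurable X]setCK; apply: measurableC.
  apply: open_borel; apply: closed_openC; apply: accessible_closed_set1.
  exact/hausdorff_accessible/norm_hausdorff.
rewrite /= (_ : (fun t => _) = (fun t => lebint (fun v : 'rV[R]_d =>
    (\1_[set x] (row_mx (const_mx t : 'rV[R]_1) v : 'rV[R]_(1 + d)) *
     f (row_mx (const_mx t : 'rV[R]_1) v : 'rV[R]_(1 + d)))%:E))) //.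
set g := fun t => lebint _.
rewrite -(integral_set1 g (x 0 0)) [RHS]integral_mkcond.
apply: eq_integral => t _; rewrite patchE; case: ifPn => //.
rewrite notin_setE /= => tx; rewrite /g -[RHS](lebint0 d); congr lebint.
apply/funext => v; rewrite indicE memNset ?mul0r// => vx; apply: tx.
have -> : x 0 0 = row_mx (const_mx t : 'rV[R]_1) v 0 (lshift d 0).
  by rewrite vx; congr (x 0 _); exact: val_inj.
by rewrite row_mxEl mxE.
Qed.

End Atoms.

(** * Union bound and almost sure counts of sample points *)

Lemma measure_bigsetU_le {disp} {T : measurableType disp} {R : realType}
  (mu : {measure set T -> \bar R}) (I : Type) (r : seq I) (Q : pred I) (F : I -> set T) :
  (forall i, measurable (F i)) ->
  (mu (\big[setU/set0]_(i <- r | Q i) F i) <= \sum_(i <- r | Q i) mu (F i))%E.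
Proof.
move=> mF; elim: r => [|i r IH]; first by rewrite !big_nil measure0.
rewrite !big_cons; case: ifP => // Qi.
have mU : measurable (\big[setU/set0]_(j <- r | Q j) F j).
  exact: bigsetU_measurable.
have -> : F i `|` \big[setU/set0]_(j <- r | Q j) F j =
    F i `|` (\big[setU/set0]_(j <- r | Q j) F j `\` F i).
  apply/seteqP; split => x [Fx|]; [by left| |by left|by case; right].
  by move=> Ux; have [Fx|nFx] := pselect (F i x); [left|right].
set U := \big[setU/set0]_(j <- r | Q j) F j in mU IH *.
have mD : measurable (U `\` F i) by exact: measurableD.
have dis : F i `&` (U `\` F i) = set0 by rewrite setDE setICA setICr setI0.
by rewrite measureU// leeD2l// (le_trans _ IH)// le_measure// ?inE//.
Qed.

Section Counts.
Context {R : realType} {disp : measure_display} {Omega : measurableType disp}.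
Variables (P : probability Omega R) (T : ptopologicalType).
Variables (X : nat -> Omega -> borel_type T) (mu : probability (borel_type T) R).
Hypothesis mX : forall i, measurable_fun setT (X i).
Hypothesis indX : mutually_independent P X.
Hypothesis lawX : forall i (A : set (borel_type T)), measurable A ->
  P (X i @^-1` A) = mu A.

Variables (A : set (borel_type T)) (m : nat).
Hypothesis mA : measurable A.
Hypothesis smallA : (mu A <= ((4 ^+ m)^-1)%:E)%E.

Definition hits (n : nat) (w : Omega) : {set 'I_n} :=
  [set i : 'I_n | X i w \in A]%SET.

Let E n (S : {set 'I_n}) : set Omega :=
  \big[setI/setT]_(i <- [seq val i | i <- enum S]) (X i @^-1` A).

Let mE n S : measurable (@E n S).
Proof.
apply: bigsetI_measurable => i _; rewrite -[X in measurable X]setTI; exact: mX.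
Qed.

Let PE n S : P (@E n S) = ((fine (mu A)) ^+ #|S|)%:E.
Proof.
rewrite /E indX//; last by rewrite map_inj_uniq ?enum_uniq//; exact: val_inj.
rewrite (eq_bigr (fun=> (fine (mu A))%:E)); last first.
  by move=> i _; rewrite lawX// fineK// fin_num_measure.
by rewrite prodEFin big_const_seq count_predT size_map -cardE iter_mulr_1.
Qed.

Definition crowded (n : nat) : set Omega := [set w | (n <= m * #|hits n w|)%N].

(** A crowded outcome lies in [E n S] for [S] its own set of hits. The pieces are measurable, and
    independence gives their probabilities as powers. *)
Let cover n : set Omega :=
  \big[setU/set0]_(S : {set 'I_n} | (n <= m * #|S|)%N) E n S.

Let crowded_cover n : crowded n `<=` cover n.
Proof.
move=> w; rewrite /crowded /= => cw; rewrite /cover (bigD1 (hits n w)) //=; left.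
rewrite /E; have : all (fun i => i \in hits n w) (enum (hits n w)).
  by apply/allP => i; rewrite mem_enum.
elim: (enum _) => [|i r IH] /=; first by rewrite big_nil.
rewrite big_cons => /andP[iw rw]; split; last exact: IH.
by move: iw; rewrite inE => /set_mem.
Qed.

(* Union bound over the [2 ^ n] index sets, each of probability at most [4 ^ - n]. *)
Let P_cover n : (P (cover n) <= (2 / (2 ^ n.+1)%:R)%:E)%E.
Proof.
apply: le_trans (measure_bigsetU_le P _ _ _ _ (mE n)) _.
apply: (@le_trans _ _ (\sum_(S : {set 'I_n}) ((4 ^+ n)^-1)%:E)%E).
  rewrite big_mkcond /=; apply: lee_sum => S _; case: ifP => [nS|_]; last first.
    by rewrite lee_fin invr_ge0 exprn_ge0.
  rewrite PE lee_fin.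
  have a0 : 0 <= fine (mu A) by rewrite fine_ge0.
  have aE : fine (mu A) <= (4 ^+ m)^-1.
    by rewrite -lee_fin fineK// fin_num_measure.
  apply: (@le_trans _ _ ((4 ^+ m)^-1 ^+ #|S|)).
    by rewrite lerXn2r ?nnegrE ?invr_ge0 ?exprn_ge0.
  rewrite exprVn -exprM lef_pV2 ?posrE ?exprn_gt0//.
  by rewrite ler_weXn2l// ler1n.
rewrite sumEFin lee_fin sumr_const -cardsT -powersetT card_powerset cardsT card_ord.
have -> : (4 : R) = 2 * 2 by ring.
have -> : (2 ^ n.+1)%:R = 2 * 2 ^+ n :> R by rewrite expnS natrM natrX.
rewrite -[leLHS]mulr_natl natrX exprMn.
have p2 : 2 ^+ n != 0 :> R by rewrite expf_neq0// pnatr_eq0.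
by rewrite le_eqVlt; apply/orP; left; apply/eqP; field; rewrite p2.
Qed.

(** Borel-Cantelli: the covers have summable probabilities, so almost every outcome is in finitely
    many of them. *)
Lemma eventually_not_crowded :
  {ae P, forall w, exists n0, forall n, (n0 <= n)%N -> (m * #|hits n w| < n)%N}.
Proof.
have mcover n : measurable (cover n) by apply: bigsetU_measurable => S _; exact: mE.
exists (lim_sup_set cover); split.
- by apply: bigcapT_measurable => n; exact: bigcup_measurable.
- apply: lim_sup_set_cvg0 => //.
  apply: (@le_lt_trans _ _ 2%:E); last by rewrite ltry.
  apply: le_trans (epsilon_trick0 xpredT (ler0n R 2)).
  by apply: lee_nneseries => // n _; exact: P_cover.
move=> w /= /forallNP nw n _; have /existsNP[k] := nw n.
move=> /not_implyP[nk /negP]; rewrite -leqNgt => kw.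
by exists k => //; exact: crowded_cover.
Qed.

End Counts.

(** * Supports, compactness and tightness on the product space *)

Section Support.
Context {R : realType}.

Lemma msupport_closed (T : ptopologicalType) (mu : set (borel_type T) -> \bar R) :
  closed (msupport mu).
Proof.
rewrite -[msupport mu]setCK; apply: open_closedC; rewrite openE => z.
move=> /existsNP[U /not_implyP[oU /not_implyP[Uz U0]]].
apply: (filterS _ (open_nbhs_nbhs (conj oU Uz))) => y Uy yS.
by apply: U0; exact: yS.
Qed.

(** The half side [T + 1] is enough because [a <= a ^ 2 + 1]. *)
Lemma sqn_ball_subcompact (k : nat) (T : R) :
  exists2 K : set 'rV[R]_k, compact K & [set v | sqn v 0 <= T] `<=` K.
Proof.
exists [set v : 'rV[R]_k | forall i, `[- (T + 1), T + 1]%classic (v 0 i)].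
  by apply: (@rV_compact _ _ (fun=> `[- (T + 1), T + 1]%classic)) => _; exact: segment_compact.
move=> v /= vT i; rewrite /= in_itv /= -ler_norml.
have := le_trans (coord_sqr_le_sqn v 0 i) vT; rewrite mxE subr0 -real_normK ?num_real//.
set y := `|v 0 i|; have := sqr_ge0 (y - 1); nra.
Qed.

Variables d s : nat.
Notation E := ('rV[R]_d * 'rV[R]_s)%type.

Lemma continuous_sqn1 (x0 : 'rV[R]_d) : continuous (fun z : E => sqn z.1 x0).
Proof.
move=> z; apply: (@continuous_comp _ _ _ fst (fun x => sqn x x0)).
  exact: cvg_fst.
exact: sqn_continuous.
Qed.

Lemma continuous_sqn2 (y0 : 'rV[R]_s) : continuous (fun z : E => sqn z.2 y0).
Proof.
move=> z; apply: (@continuous_comp _ _ _ snd (fun x => sqn x y0)).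
  exact: cvg_snd.
exact: sqn_continuous.
Qed.

Variable mu : probability (BT R d s) R.

(** Continuity from above along sets decreasing to the empty set. *)
Lemma tight2 (e : R) : 0 < e -> exists T : R, (mu [set z | (T < sqn z.2 0)%R] < e%:E)%E.
Proof.
move=> e0; pose F n : set (BT R d s) := [set z : E | n%:R < sqn z.2 0].
have mF n : measurable (F n).
  by apply: borel_gt; exact: continuous_sqn2.
have F0 : \bigcap_n F n = set0.
  apply/seteqP; split => // z Fz; have := Fz (Num.bound (sqn z.2 0)) I.
  by rewrite /F /= ltNge ltW// archi_boundP// sqn_ge0.
have : (mu \o F) x @[x --> \oo] --> 0%E.
  rewrite -(measure0 mu) -F0; apply: nonincreasing_cvg_mu => //.
  - by rewrite (le_lt_trans (probability_le1 _ _))// ltry.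
  - exact: bigcapT_measurable.
  - move=> n k nk; apply/subsetPset => y; rewrite /F /=; apply: le_lt_trans.
    by rewrite ler_nat.
have nb : ereal_nbhs 0%E (fun u : \bar R => (u < e%:E)%E).
  by apply: open_ereal_lt'; rewrite lte_fin.
by move=> /(_ _ nb) [n _ /(_ n (leqnn n)) /= Fn]; exists n%:R.
Qed.

Lemma msupport_le (g : E -> R) (b : R) : continuous g ->
  mu [set z | b <= g z] = 0%E -> forall z, msupport mu z -> g z <= b.
Proof.
move=> cg mu0 z zS; rewrite leNgt; apply/negP => bz.
have oU : open [set z | b < g z] by exact: open_gt_continuous.
have := zS _ oU bz; apply/negP; rewrite -leNgt -mu0 le_measure ?inE//.
- exact: open_borel.
- exact: borel_ge.
- by move=> y /= /ltW.
Qed.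

End Support.

(** * The weak limit for a fixed sequence of data points *)

Section Limit.
Context {R : realType} {d s : nat}.
Variables (rho : R) (m : nat) (x : nat -> 'rV[R]_d) (Dl : R).
Hypotheses (rho01 : 0 < rho < 1) (m_rho : 4 < m%:R * rho ^+ 2).
Hypothesis x_bounded : forall j, sqn (x j) 0 <= Dl.
Hypothesis x_spread : forall x0, exists2 r : R, 0 < r & exists n0, forall n,
  (n0 <= n)%N -> (m * #|[set j : 'I_n | (sqn (x j) x0 < r)%R]%SET| < n)%N.
Variables (sig : forall n : nat, 'I_n -> R) (Y : nat -> nat -> 'rV[R]_s).
Variables (nk : nat -> nat) (mu : probability (BT R d s) R).
Hypothesis nk_incr : forall k, (nk k < nk k.+1)%N.
Hypothesis nk_ge2 : forall k, (2 <= nk k)%N.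
Hypothesis cal : forall k, calibrated rho (fun i : 'I_(nk k) => x i) (sig (nk k)).
Hypothesis minY : forall k,
  is_tsne_minimizer (fun i : 'I_(nk k) => x i) (sig (nk k))
    (fun i : 'I_(nk k) => Y (nk k) i).
Hypothesis cvg_mu : weak_cvg (fun k => @empirical R _ (nk k)
  (fun i : nat => ((x i, Y (nk k) i) : BT R d s))) mu.

Let nk_gt0 k : (0 < nk k)%N. Proof. exact: leq_trans (nk_ge2 k). Qed.

Let nk_large n0 : \forall k \near \oo, (n0 <= nk k)%N.
Proof.
have nk_ge k : (k <= nk k)%N by elim: k => // k IH; exact: leq_ltn_trans (nk_incr k).
by exists n0 => // k /= n0k; exact: leq_trans (nk_ge k).
Qed.

(** The point [z0] provides the attracting set: by weak convergence a fixed fraction of the pairs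
    eventually lies near it. *)
Lemma limit_embedding_bounded (z0 : 'rV[R]_d * 'rV[R]_s) : msupport mu z0 ->
  exists T : R, \forall k \near \oo, forall i : 'I_(nk k), sqn (Y (nk k) i) 0 <= T.
Proof.
case: z0 => x0 y0 z0S.
have [r r0 [n0 spread]] := x_spread x0.
(* Points within [eta] of [x0] are within [4 * eta] of each other and at least [r / 2 - eta] from
   the points outside the ball; [r / 20] separates the two values. *)
pose eta := r / 20; have eta0 : 0 < eta by rewrite divr_gt0.
(* A single function controls both components: [g > -1] gives distance below [eta] from [x0] and
   below 1 from [y0]. The level [- 2^-1] leaves room for the ramp. *)
pose g (z : 'rV[R]_d * 'rV[R]_s) := - (sqn z.1 x0 / eta + sqn z.2 y0).
have cg : continuous g.
  move=> z; apply: (@continuousN _ _ _ (fun z => sqn z.1 x0 / eta + sqn z.2 y0)).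
  apply: (@continuousD _ _ _ (fun z => sqn z.1 x0 / eta)); last exact: continuous_sqn2.
  apply: (@continuousM _ _ (fun z => sqn z.1 x0) (fun=> eta^-1)).
    exact: continuous_sqn1.
  exact: cst_continuous.
have mass0 : (0 < mu [set z | (- 2^-1 < g z)%R])%E.
  apply: z0S; first exact: open_gt_continuous.
  by rewrite /= /g /= !sqnn mul0r addr0 oppr0 oppr_lt0 invr_gt0.
pose theta := fine (mu [set z | - 2^-1 < g z]) / 2.
have fmass : (mu [set z | (- 2^-1 < g z)%R]) \is a fin_num.
  by apply: fin_num_measure; exact: borel_gt.
have theta0 : 0 < theta.
  by rewrite divr_gt0// fine_gt0// mass0 ltey_eq fmass.
have theta_mass : (theta%:E < mu [set z | (- 2^-1 <= g z)%R])%E.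
  apply: (@lt_le_trans _ _ (mu [set z | (- 2^-1 < g z)%R])).
    rewrite -[ltRHS]fineK// lte_fin /theta.
    move: theta0; rewrite /theta; lra.
  rewrite le_measure ?inE//.
  - exact: borel_gt.
  - exact: borel_ge.
  - by move=> y /= /ltW.
have ab : -1 < - 2^-1 :> R by lra.
have := weak_cvg_freq_gt nk _ mu cvg_mu nk_gt0 g (-1) (- 2^-1) cg ab theta theta_mass.
set J := fun k => [set i : 'I_(nk k) | -1 < g (x i, Y (nk k) i)]%SET.
rewrite -/(J _) => Jlarge.
pose B := 2 + 2 * sqn y0 0.
have B1 : 1 <= B by rewrite /B; have := sqn_ge0 y0 0; lra.
(* The bound of [calibrated_bandwidth] for the two distances above, with [theta / 2] because [j]
   itself is taken out of [J]. *)
pose M := ln (2 / (theta / 2)) / ((r / 2 - eta) - 4 * eta).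
(* Two data points are at squared distance at most [4 * Dl]; the half comes from symmetrizing the
   affinities. *)
pose c := expR (- (4 * Dl * M)) / 2.
have c0 : 0 < c by rewrite divr_gt0// expR_gt0.
have [eps eps0 /= bound] := uniform_bound c theta B c0 theta0 B1.
have [T0 T0P] := tight2 _ _ mu eps eps0.
have T01 : T0 < T0 + 1 by lra.
have tailsmall := weak_cvg_freq_lt nk _ mu cvg_mu nk_gt0 _ T0 (T0 + 1)
  (continuous_sqn2 d s 0) T01 eps T0P.
have [T1 T1P] := bound (T0 + 1).
exists T1; near=> k.
have n_bound : (Num.bound (2 / theta) <= nk k)%N by near: k; exact: nk_large.
have n_n0 : (n0 <= nk k)%N by near: k; exact: nk_large.
have Jk : theta * (nk k)%:R < #|J k|%:R by near: k; exact: Jlarge.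
have tailk : #|[set i : 'I_(nk k) | T0 + 1 <= sqn (Y (nk k) i) 0]%SET|%:R <
    eps * (nk k)%:R by near: k; exact: tailsmall.
have n2 := nk_ge2 k; move: (cal k) (minY k) => calk minYk.
set n := nk k in n2 n_bound n_n0 Jk tailk calk minYk *.
have n_gt0 : 0 < n%:R :> R by rewrite ltr0n nk_gt0.
have nl : 2 <= theta * n%:R.
  rewrite mulrC -ler_pdivrMr//.
  move: n_bound; rewrite -(ler_nat R); apply: le_trans; apply/ltW/archi_boundP.
  by rewrite divr_ge0// ltW.
have JP (j : 'I_n) : j \in J k -> sqn (x j) x0 < eta /\ sqn (Y n j) y0 < 1.
  rewrite inE /g /= => gj.
  have h1 : 0 <= sqn (x j) x0 / eta by rewrite divr_ge0 ?sqn_ge0// ltW.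
  have h2 := sqn_ge0 (Y n j) y0.
  have h3 : sqn (x j) x0 / eta < 1 by move: gj h2; rewrite -/n; lra.
  split; first by move: h3; rewrite ltr_pdivrMr// mul1r.
  by move: gj h1; rewrite -/n; lra.
apply: (T1P s n (pjoint (fun i : 'I_n => x i) (sig n)) (fun i : 'I_n => Y n i) (J k)) => //.
- by move=> i j; exact: pjoint_ge0.
- by move=> h; exact: minimizer_contraction minYk.
- exact: ltW.
- move=> j /JP[_ jy]; have := sqn_le2 (Y n j) y0 0; rewrite /B; lra.
- move=> i j jJ ji; apply: (pjoint_ge _ (sig n)) => //.
  have [jx _] := JP j jJ.
  have nearfar : 4 * eta < r / 2 - eta by rewrite /eta; lra.
  have bw : (2 * sig n j ^+ 2)^-1 <= M.
    apply: (calibrated_bandwidth (fun i : 'I_n => x i) (sig n) rho m n2 rho01 m_rho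
      calk [set j : 'I_n | sqn (x j) x0 < r]%SET (J k :\ j)%SET j) => //.
    + exact/ltnW/spread.
    + by rewrite divr_gt0.
    (* Removing [j] costs one index, which is at most [theta * n / 2] by [nl]. *)
    + have := Jk; rewrite (cardsD1 j (J k)) jJ natrD mulr1n; move: nl; lra.
    + by rewrite !inE eqxx.
    + move=> l; rewrite inE -leNgt => rl; rewrite sqnC.
      have := sqn_le2 (x l) (x j) x0; lra.
    + move=> l; rewrite in_setD1 => /andP[_ /JP[lx _]].
      have := sqn_le2 (x j) x0 (x l); rewrite [sqn x0 _]sqnC; lra.
  apply: (pcond_ge _ (sig n) rho) => //.
    have [sj0 _] := calk j; apply: le_trans bw.
    by rewrite invr_ge0 mulr_ge0// exprn_ge0// ltW.
  have := sqn_le2 (x j) 0 (x i); rewrite [sqn 0 _]sqnC.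
  have := x_bounded j; have := x_bounded i; lra.
- by rewrite /tail ler_pdivrMr// ltW.
Unshelve. all: by end_near. Qed.

Lemma limit_support_compact : compact (msupport mu).
Proof.
(* The bound on the embedding starts from a point of the support, so the empty support is treated
   apart. *)
have [->|/set0P[z0 z0S]] := eqVneq (msupport mu) set0; first exact: compact0.
have [T YT] := limit_embedding_bounded z0 z0S.
(* [weak_cvg_freq_gt] with [c = 0]: positive mass would produce a sample point with [g > b]. *)
have mass0 (g : 'rV[R]_d * 'rV[R]_s -> R) (b : R) : continuous g ->
    (\forall k \near \oo, forall i : 'I_(nk k), g (x i, Y (nk k) i) <= b) ->
    mu [set z | b + 1 <= g z] = 0%E.
  move=> cg gb; apply/eqP; rewrite -measure_le0 leNgt; apply/negP => mpos.
  have bb : b < b + 1 by lra.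
  have := weak_cvg_freq_gt nk _ mu cvg_mu nk_gt0 g b (b + 1) cg bb 0 mpos.
  move=> /(filterI gb)/filter_ex[k [gk]].
  rewrite mul0r ltr0n => /card_gt0P[i]; rewrite inE ltNge.
  by rewrite gk.
have xDl : \forall k \near \oo, forall i : 'I_(nk k), sqn (x i) 0 <= Dl.
  by apply: nearW => k i; exact: x_bounded.
have sup1 := msupport_le _ _ mu _ _ (continuous_sqn1 d s 0)
  (mass0 _ Dl (continuous_sqn1 d s 0) xDl).
have sup2 := msupport_le _ _ mu _ _ (continuous_sqn2 d s 0)
  (mass0 _ T (continuous_sqn2 d s 0) YT).
have [K1 cK1 sK1] := sqn_ball_subcompact d (Dl + 1).
have [K2 cK2 sK2] := sqn_ball_subcompact s (T + 1).
apply: subclosed_compact (msupport_closed _ _) (compact_setX cK1 cK2) _.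
by move=> z zS; split; [apply: sK1; exact: sup1|apply: sK2; exact: sup2].
Qed.

End Limit.

(** * The almost sure statement for independent samples *)

Theorem theorem1p2 (R : realType) (d s : nat) (rho : R)
  (muX : probability (borel_type 'rV[R]_d) R) (fX : 'rV[R]_d -> R)
  (dO : measure_display) (Omega : measurableType dO) (P : probability Omega R)
  (X : nat -> Omega -> borel_type 'rV[R]_d) :
  (2 <= d)%N -> (2 <= s)%N -> 0 < rho < 1 ->
  has_density muX fX -> C1 fX -> compact (msupport muX) ->
  (forall i, measurable_fun setT (X i)) ->
  mutually_independent P X ->
  (forall i (A : set (borel_type 'rV[R]_d)), measurable A ->
     P (X i @^-1` A) = muX A) ->
  {ae P, forall omega : Omega,
    forall (sig : forall n : nat, 'I_n -> R)
           (Ystar : nat -> nat -> 'rV[R]_s)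
           (nk : nat -> nat) (mustar : probability (BT R d s) R),
      (forall k, (nk k < nk k.+1)%N) ->
      (forall k, (2 <= nk k)%N /\
         calibrated rho (fun i : 'I_(nk k) => X i omega) (sig (nk k)) /\
         is_tsne_minimizer (fun i : 'I_(nk k) => X i omega) (sig (nk k))
           (fun i : 'I_(nk k) => Ystar (nk k) i)) ->
      weak_cvg (fun k => @empirical R _ (nk k)
                  (fun i : nat => ((X i omega, Ystar (nk k) i)
                                   : BT R d s)))
               mustar ->
      Irho rho mustar =
        ereal_inf [set Irho rho mu | mu in [set mu : probability (BT R d s) R
                                             | in_PtX rho muX mu]] ->
      compact (msupport mustar)}.
Proof.
(* A successor dimension lets [density_no_atom] apply. *)
case: d muX fX X => // d muX fX X _ _ rho01 dens _ cS mX indX lawX.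
have rho0 : 0 < rho by case/andP: rho01.
(* Calibration at level [rho] spreads half of each kernel outside any set holding at most a fraction
   [1 / m] of the points. *)
pose m := Num.bound (4 / rho ^+ 2).
have m_rho : 4 < m%:R * rho ^+ 2.
  by rewrite -ltr_pdivrMr ?exprn_gt0// archi_boundP// divr_ge0// sqr_ge0.
have [Dl DlP] : exists Dl : R, forall x, msupport muX x -> sqn x 0 <= Dl.
  have : compact ((fun x => sqn x 0) @` msupport muX).
    apply: continuous_compact => //; apply: continuous_subspaceT; exact: sqn_continuous.
  move=> /compact_bounded[M [_ MP]]; exists (M + 1) => x xS.
  have := MP (M + 1); rewrite ltrDl ltr01 => /(_ isT (sqn x 0)).
  rewrite /= ger0_norm ?sqn_ge0//; apply; by exists x.
have suppX : {ae P, forall w, forall j, msupport muX (X j w)}.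
  apply: ae_foralln => j; have [N [mN N0 sN]] := msupport_negligible muX.
  exists (X j @^-1` N); split; last by move=> w /= ?; exact: sN.
    by rewrite -[X in measurable X]setTI; exact: mX.
  by have := lawX j N mN; rewrite N0.
(* All rational balls of small mass are treated at once, so the exceptional null set is fixed before
   the subsequence, its limit and the centre [x0] are chosen. *)
have countX : {ae P, forall w, forall l : nat,
    if unpickle l is Some i then (muX (qball i) <= ((4 ^+ m)^-1)%:E)%E ->
      exists n0, forall n, (n0 <= n)%N -> (m * #|hits _ X (qball i) n w| < n)%N
    else True}.
  apply: ae_foralln => l; case: unpickle => [i|]; last exact: aeW.
  have [small|nsmall] := pselect (muX (qball i) <= ((4 ^+ m)^-1)%:E)%E.
    have := eventually_not_crowded P _ X muX mX indX lawX _ m (qball_measurable i) small.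
    by apply: filterS => w ?.
  by apply: aeW => w /nsmall.
apply: filterS2 suppX countX => w suppX countX sig Ystar nk mustar incr H wc _.
apply: (limit_support_compact rho m (fun j => X j w) Dl rho01 m_rho _ _ sig Ystar nk) => //.
- by move=> j; exact/DlP/suppX.
- move=> x0; have e0 : 0 < (4 ^+ m)^-1 :> R by rewrite invr_gt0 exprn_gt0.
  have [i ix0 small] := small_qball muX x0 _ (density_no_atom _ _ _ x0 dens) e0.
  have nb : nbhs x0 (qball i) by apply: open_nbhs_nbhs; split => //; exact: sqn_ball_open.
  have [r r0 rP] := nbhs_sqn x0 _ nb; exists r => //.
  have := countX (pickle i); rewrite pickleK => /(_ (ltW small)) [n0 n0P].
  exists n0 => n /n0P; apply: leq_ltn_trans; rewrite leq_mul2l; apply/orP; right.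
  apply: subset_leq_card; apply/fintype.subsetP => j; rewrite !inE => jr.
  by apply: rP; rewrite /= sqnC.
- by move=> k; case: (H k).
- by move=> k; case: (H k) => _ [].
- by move=> k; case: (H k) => _ [].
Qed.
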